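(* Let $(\Omega,\mathcal{F})$ be a measurable space, $T:\Omega\to\Omega$ measurable, and $V$ a $T$-invariant upper probability. The following are equivalent: (i) $V$ is weakly mixing; (ii) there exists $Q\in\operatorname{core}(V)\cap\mathcal{M}^{wm}(T)$ such that for every $P\in\operatorname{core}(V)$, $\lim_{n\to\infty}\frac{1}{n}\sum_{i=0}^{n-1}|P(B\cap T^{-i}C)-P(B)Q(C)|^2=0$ for all $B,C\in\mathcal{F}$; (iii) there exists $Q\in\operatorname{core}(V)\cap\mathcal{M}(T)$ such that for every $P\in\operatorname{core}(V)$, $\lim_{n\to\infty}\frac{1}{n}\sum_{i=0}^{n-1}|P(B\cap T^{-i}C)-P(B)Q(C)|^2=0$ for all $B,C\in\mathcal{F}$.
   Context: A capacity is a monotone map $\mu:\mathcal{F}\to[0,1]$ with $\mu(\emptyset)=0,\mu(\Omega)=1$. An upper probability is a capacity $V$ with $V(A)=\max_{P\in\Lambda}P(A)$ for a weak* (setwise convergence) compact set $\Lambda$ of probabilities; $\operatorname{core}(V)$ is the set of finitely additive normalized $P\le V$. A $T$-invariant capacity $\mu$ is weakly mixing if every measurable $f:\Omega\to\mathbb{C}$ with $f\circ T=\lambda f$ $\mu$-a.s. for some $\lambda\in\mathbb{C}$ is constant $\mu$-a.s. $\mathcal{M}(T)$: $T$-invariant probabilities; $\mathcal{M}^{wm}(T)$: those $P\in\mathcal{M}(T)$ with $P\times P$ ergodic for $T\times T$. *)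

(* Defs.v *)
From HB Require Import structures.
From mathcomp Require Import all_boot all_order all_algebra.
From mathcomp Require Import all_classical all_reals all_analysis.
From mathcomp Require Import complex.
Set Implicit Arguments. Unset Strict Implicit. Unset Printing Implicit Defensive.
Import Order.TTheory GRing.Theory Num.Theory.
Import numFieldNormedType.Exports.
Local Open Scope classical_set_scope.
Local Open Scope ring_scope.

Section Defs.
Context {d : measure_display} {Omega : measurableType d} {R : realType}.

(* A capacity: monotone normalized set function on the measurable sets,
   with values in [0,1]. Values on non-measurable sets are irrelevant. *)
Definition capacity (mu : set Omega -> R) : Prop :=
  mu set0 = 0 /\ mu setT = 1 /\
  (forall A, measurable A -> 0 <= mu A <= 1) /\
  (forall A B, measurable A -> measurable B -> A `<=` B -> mu A <= mu B).

(* Setwise-convergence (weak* ) topology on probabilities: the initial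
   topology of the evaluation map P |-> (A |-> P(A)) (A measurable) into the
   product space of real-valued functions on sets; a set of probabilities is
   compact in it iff its image under this map is compact. *)
Definition setwise_eval (P : probability Omega R) : {ptws set Omega -> R} :=
  fun A => if `[< measurable A >] then fine (P A) else 0.

Definition setwise_compact (Lambda : set (probability Omega R)) : Prop :=
  compact (setwise_eval @` Lambda).

Definition upper_probability (V : set Omega -> R) : Prop :=
  capacity V /\
  exists Lambda : set (probability Omega R),
    setwise_compact Lambda /\
    forall A, measurable A ->
      (forall P, Lambda P -> P A <= (V A)%:E)%E /\
      exists2 P, Lambda P & P A = (V A)%:E.

Definition core (V : set Omega -> R) (P : set Omega -> R) : Prop :=
  P set0 = 0 /\ P setT = 1 /\
  (forall A, measurable A -> 0 <= P A) /\
  (forall A B, measurable A -> measurable B -> A `&` B = set0 ->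
     P (A `|` B) = P A + P B) /\
  (forall A, measurable A -> P A <= V A).

Definition cap_invariant (T : Omega -> Omega) (mu : set Omega -> R) : Prop :=
  forall A, measurable A -> mu (T @^-1` A) = mu A.

Definition cap_as (mu : set Omega -> R) (p : Omega -> Prop) : Prop :=
  exists N, measurable N /\ mu N = 0 /\ forall x, ~ N x -> p x.

Definition measurable_C (f : Omega -> R[i]) : Prop :=
  measurable_fun setT (fun x => complex.Re (f x)) /\
  measurable_fun setT (fun x => complex.Im (f x)).

Definition cap_weakly_mixing (T : Omega -> Omega) (mu : set Omega -> R) : Prop :=
  forall (f : Omega -> R[i]) (lam : R[i]), measurable_C f ->
    cap_as mu (fun x => f (T x) = lam * f x) ->
    exists c : R[i], cap_as mu (fun x => f x = c).

Definition invariant_prob (T : Omega -> Omega) (P : probability Omega R) : Prop :=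
  forall A, measurable A -> P (T @^-1` A) = P A.

Definition weakly_mixing_prob (T : Omega -> Omega) (P : probability Omega R) : Prop :=
  invariant_prob T P /\
  forall A : set (Omega * Omega), measurable A ->
    (fun z => (T z.1, T z.2)) @^-1` A = A ->
    ((P \x P)%E A = 0%E \/ (P \x P)%E A = 1%E).

Definition mixing_cond (T : Omega -> Omega) (V : set Omega -> R)
    (Q : probability Omega R) : Prop :=
  forall P, core V P ->
  forall B C, measurable B -> measurable C ->
    (fun n : nat => n%:R^-1 *
       \sum_(i < n) `| P (B `&` (iter i T @^-1` C)) - P B * fine (Q C) | ^+ 2)
      @ \oo --> (0 : R).

End Defs.

(* Main.v *)
Require Import Defs.
From HB Require Import structures.
From mathcomp Require Import all_boot all_order all_algebra.
From mathcomp Require Import all_classical all_reals all_analysis.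
From mathcomp Require Import measurable_realfun complex lra ring zify.
Set Implicit Arguments. Unset Strict Implicit. Unset Printing Implicit Defensive.
Import Order.TTheory GRing.Theory Num.Theory.
Import numFieldNormedType.Exports.
Local Open Scope classical_set_scope.
Local Open Scope ring_scope.

(**
  A weakly mixing [V] is ergodic, so by compactness of the defining set of
  probabilities an invariant [Q] in the core dominates [V]: if [Q N = 0], the
  set of points visiting [N] infinitely often is invariant, [Q]-null and has at
  least the capacity of [N]. Hence [Q] has no nonconstant eigenfunction and
  every [P] in the core is absolutely continuous with respect to [Q].

  Absence of eigenfunctions is turned into decay of correlations without the
  spectral theorem. For [f = 1_B - Q B] and an angle [t], the infimum of
  [E |sum_n p_n e^(int) f o T^n|^2] over the polynomials [p] with [p(1) = 1] is
  approached by the Cesaro averages; were it positive, they would converge to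
  an eigenfunction of mean [0]. So it vanishes for every [t], and by
  compactness of the circle the Cesaro averages tend to [0] in L^2 uniformly in
  [t]; Parseval then gives [N^-2 sum_(i,j<N) b(i,j)^2 -> 0] for the
  correlations [b(i,j) = E (f o T^i) (f o T^j)]. Both the mixing condition for
  all [P << Q] and the ergodicity of [Q x Q] are second moment computations
  from this.

  Conversely, under (iii) an eigenfunction [f] with eigenvalue in the closed
  unit disc does not spread a set on which its oscillation is small, whereas
  mixing sends positive parts of that set simultaneously to [Re f <= a] and to
  [Re f >= b].
*)

Lemma cvg_invn (R : realType) : (n%:R^-1 : R) @[n --> \oo] --> (0 : R).
Proof. by rewrite -(cvg_shiftS (fun n => n%:R^-1 : R)); exact: cvg_harmonic. Qed.

(** * Expectations of bounded measurable functions *)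

Section bounded_measurable.
Context {d : measure_display} {Omega : measurableType d} {R : realType}.
Implicit Types (f g : Omega -> R) (A : set Omega) (T : Omega -> Omega).

Definition bounded_mfun f :=
  measurable_fun setT f /\ exists M, forall x, `|f x| <= M.

Lemma bounded_mfun_cst (c : R) : bounded_mfun (fun=> c).
Proof. by split; [exact: measurable_cst|exists `|c|]. Qed.

Lemma bounded_mfunD f g : bounded_mfun f -> bounded_mfun g ->
  bounded_mfun (fun x => f x + g x).
Proof.
move=> [mf [M fM]] [mg [N gN]]; split; first exact: measurable_funD.
by exists (M + N) => x; rewrite (le_trans (ler_normD _ _))// lerD.
Qed.

Lemma bounded_mfunM f g : bounded_mfun f -> bounded_mfun g ->
  bounded_mfun (fun x => f x * g x).
Proof.
move=> [mf [M fM]] [mg [N gN]]; split; first exact: measurable_funM.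
by exists (M * N) => x; rewrite normrM ler_pM.
Qed.

Lemma bounded_mfunZ (c : R) f : bounded_mfun f -> bounded_mfun (fun x => c * f x).
Proof. by move=> bf; apply: bounded_mfunM => //; exact: bounded_mfun_cst. Qed.

Lemma bounded_mfunB f g : bounded_mfun f -> bounded_mfun g ->
  bounded_mfun (fun x => f x - g x).
Proof.
move=> bf bg; apply: bounded_mfunD => //.
by under eq_fun do rewrite -mulN1r; exact: bounded_mfunZ.
Qed.

Lemma bounded_mfunX f : bounded_mfun f -> bounded_mfun (fun x => f x ^+ 2).
Proof. by move=> bf; exact: (bounded_mfunM bf bf). Qed.

Lemma bounded_mfun_norm f : bounded_mfun f -> bounded_mfun (fun x => `|f x|).
Proof.
move=> [mf [M fM]]; split; first exact: measurableT_comp.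
by exists M => x; rewrite normr_id.
Qed.

Lemma bounded_mfun_sum (I : Type) (r : seq I) (F : I -> Omega -> R) :
  (forall i, bounded_mfun (F i)) -> bounded_mfun (fun x => \sum_(i <- r) F i x).
Proof.
move=> bF; elim: r => [|i r ih].
  by under eq_fun do rewrite big_nil; exact: bounded_mfun_cst.
by under eq_fun do rewrite big_cons; exact: bounded_mfunD.
Qed.

Lemma bounded_mfun_indic A : measurable A -> bounded_mfun \1_A.
Proof.
move=> mA; split; first exact: measurable_indic.
by exists 1 => x; rewrite indicE normr_nat; case: (_ \in _); rewrite ?ler01.
Qed.

Lemma bounded_mfun_comp f T : measurable_fun setT T -> bounded_mfun f ->
  bounded_mfun (fun x => f (T x)).
Proof.
by move=> mT [mf [M fM]]; split; [exact: measurableT_comp|exists M => x].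
Qed.

Variable P : probability Omega R.

Lemma bounded_mfun_integrable f : bounded_mfun f ->
  P.-integrable setT (EFin \o f).
Proof.
move=> [mf [M fM]]; apply: measurable_bounded_integrable => //.
  by rewrite [X in (X < _)%E](probability_setT P) ltry.
by exists M; split; [exact: num_real|move=> N MN x _ /=; exact: le_trans (ltW MN)].
Qed.
Hint Resolve bounded_mfun_integrable : core.

Local Notation "''E' f" := (Rintegral P setT f) (at level 10, f at level 8).

Lemma expect_cst (c : R) : 'E (fun=> c) = c.
Proof. by rewrite Rintegral_cst// [X in fine X](probability_setT P) /= mulr1. Qed.

Lemma expectD f g : bounded_mfun f -> bounded_mfun g ->
  'E (fun x => f x + g x) = 'E f + 'E g.
Proof. by move=> bf bg; rewrite RintegralD//; exact: bounded_mfun_integrable. Qed.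

Lemma expectB f g : bounded_mfun f -> bounded_mfun g ->
  'E (fun x => f x - g x) = 'E f - 'E g.
Proof. by move=> bf bg; rewrite RintegralB//; exact: bounded_mfun_integrable. Qed.

Lemma expectZ (c : R) f : bounded_mfun f -> 'E (fun x => c * f x) = c * 'E f.
Proof. by move=> bf; rewrite RintegralZl//; exact: bounded_mfun_integrable. Qed.

Lemma expect_sum (I : Type) (r : seq I) (F : I -> Omega -> R) :
  (forall i, bounded_mfun (F i)) ->
  'E (fun x => \sum_(i <- r) F i x) = \sum_(i <- r) 'E (F i).
Proof.
move=> bF; elim: r => [|i r ih].
  by under eq_Rintegral do rewrite big_nil; rewrite expect_cst big_nil.
under eq_Rintegral do rewrite big_cons.
by rewrite big_cons expectD ?ih//; exact: bounded_mfun_sum.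
Qed.

Lemma expect_ge0 f : (forall x, 0 <= f x) -> 0 <= 'E f.
Proof. by move=> f0; apply: Rintegral_ge0. Qed.

Lemma expect_le f g : bounded_mfun f -> bounded_mfun g ->
  (forall x, f x <= g x) -> 'E f <= 'E g.
Proof.
by move=> bf bg fg; apply: le_Rintegral => //; exact: bounded_mfun_integrable.
Qed.

Lemma expect_indic A : measurable A -> 'E \1_A = fine (P A).
Proof. by move=> mA; rewrite /Rintegral integral_indic// setIT. Qed.

Lemma expect_norm f : bounded_mfun f -> `|'E f| <= 'E (fun x => `|f x|).
Proof. by move=> bf; apply: le_normr_Rintegral => //; exact: bounded_mfun_integrable. Qed.

Lemma fine_prob_ge0 A : 0 <= fine (P A).
Proof. exact: fine_ge0. Qed.

Lemma fine_probE A : measurable A -> (fine (P A))%:E = P A.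
Proof. by move=> mA; rewrite fineK// fin_num_measure. Qed.

Lemma fine_prob_le1 A : measurable A -> fine (P A) <= 1.
Proof. by move=> mA; rewrite -lee_fin fine_probE// probability_le1. Qed.

Lemma fine_prob_le A B : measurable A -> measurable B -> A `<=` B ->
  fine (P A) <= fine (P B).
Proof. by move=> mA mB AB; rewrite -lee_fin !fine_probE// le_measure ?inE. Qed.

Lemma fine_probU A B : measurable A -> measurable B -> A `&` B = set0 ->
  fine (P (A `|` B)) = fine (P A) + fine (P B).
Proof.
move=> mA mB AB; apply: EFin_inj; rewrite EFinD !fine_probE ?measureU//.
exact: measurableU.
Qed.

Lemma fine_prob_eq0 A : measurable A -> fine (P A) = 0 <-> P A = 0%E.
Proof. by move=> mA; rewrite -(fine_probE mA); split => [/= ->|[]]. Qed.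

Lemma chebyshev_sqr f (e : R) : bounded_mfun f -> 0 < e ->
  fine (P [set x | e <= `|f x|]) <= 'E (fun x => f x ^+ 2) / e ^+ 2.
Proof.
move=> bf e0.
have mA : measurable [set x | e <= `|f x|].
  rewrite -[X in measurable X]setTI.
  by apply: measurable_fun_le => //; apply: measurableT_comp => //; case: bf.
rewrite -expect_indic// ler_pdivlMr ?exprn_gt0// mulrC -expectZ;
  last exact: bounded_mfun_indic.
apply: expect_le => [||x]; first exact/bounded_mfunZ/bounded_mfun_indic.
  exact: bounded_mfunX.
rewrite indicE; case: (boolP (x \in _)) => [/set_mem /= ex|_];
  last by rewrite mulr0 sqr_ge0.
by rewrite mulr1 -(real_normK (num_real (f x))) ler_sqr ?nnegrE// ltW.
Qed.

(* [|X| <= t + X^2 / t] replaces Cauchy-Schwarz. *)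
Lemma expect_norm_le_sqr f (t : R) : bounded_mfun f -> 0 < t ->
  'E (fun x => `|f x|) <= t + 'E (fun x => f x ^+ 2) / t.
Proof.
move=> bf t0; rewrite -[t in leRHS]expect_cst mulrC -expectZ; last exact: bounded_mfunX.
rewrite -expectD; [|exact: bounded_mfun_cst|exact/bounded_mfunZ/bounded_mfunX].
apply: expect_le => [||x]; first exact: bounded_mfun_norm.
  apply: bounded_mfunD; first exact: bounded_mfun_cst.
  exact/bounded_mfunZ/bounded_mfunX.
rewrite expect_cst -(real_normK (num_real (f x))); set y := `|f x|.
have -> : t + t^-1 * y ^+ 2 = y + t^-1 * ((t - y) ^+ 2 + t * y).
  by field; rewrite gt_eqF.
rewrite lerDl; apply: mulr_ge0; first by rewrite invr_ge0 ltW.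
by apply: addr_ge0; [exact: sqr_ge0|apply: mulr_ge0; [exact: ltW|exact: normr_ge0]].
Qed.

Lemma expect_cvg (F : nat -> Omega -> R) f (M : R) :
  (forall n, measurable_fun setT (F n)) -> measurable_fun setT f ->
  (forall n x, `|F n x| <= M) ->
  {ae P, forall x, F n x @[n --> \oo] --> f x} ->
  'E (F n) @[n --> \oo] --> 'E f.
Proof.
move=> mF mf FM Ff.
have [] := @dominated_convergence _ _ _ P setT measurableT
    (fun n x => (F n x)%:E) (EFin \o f) (cst M%:E).
- by move=> n; apply/measurable_EFinP.
- exact/measurable_EFinP.
- by apply: filterS Ff => x Fx _; apply: cvg_EFin => //; exact: nearW.
- exact: (bounded_mfun_integrable (bounded_mfun_cst M)).
- by apply: aeW => x n _; rewrite /= lee_fin.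
move=> intf _; rewrite -[X in _ --> X]fineK; last exact: integrable_fin_num.
by move/fine_cvg.
Qed.

End bounded_measurable.

(** If a proper filter [G] finer than the image contained [A] while [F] missed the preimage of [A],
    then [F] would contain the preimage of the complement, and [G] both [A] and its complement. *)
Lemma fmap_ultra (X Y : Type) (f : X -> Y) (F : set_system X) :
  UltraFilter F -> UltraFilter (f @ F).
Proof.
move=> FU; split; first exact: fmap_proper_filter.
move=> G GP FG; apply/seteqP; split; last exact: FG.
move=> A GA; have [//|FCA] := @in_ultra_setVsetC _ F (f @^-1` A) FU.
have /filter_ex[y []] : G (A `&` ~` A) by apply: filterI => //; exact: FG.
by [].
Qed.

(** * Upper probabilities: continuity from above, core, invariant elements *)

Section upper_probability.
Context {d : measure_display} {Omega : measurableType d} {R : realType}.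
Implicit Types (V : set Omega -> R) (A B N : set Omega) (P Q : probability Omega R).

Lemma prob_nonincreasing_ge P (F : nat -> set Omega) (v : R) :
  (forall n, measurable (F n)) -> nonincreasing_seq F ->
  (forall n, v <= fine (P (F n))) -> v <= fine (P (\bigcap_n F n)).
Proof.
move=> mF niF vF.
have mI : measurable (\bigcap_n F n) by apply: bigcap_measurable => //.
have PF : P \o F @ \oo --> P (\bigcap_n F n).
  apply: nonincreasing_cvg_mu => //.
  by apply: le_lt_trans (probability_le1 P (mF 0%N)) _; exact: ltry.
rewrite -lee_fin fine_probE//.
rewrite -(cvg_lim _ PF)//; apply: lime_ge; first by apply: cvgP PF.
by apply: nearW => n /=; rewrite -fine_probE ?lee_fin.
Qed.

Lemma upper_probability_core V A : upper_probability V -> measurable A ->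
  exists P, core V (fun B => fine (P B)) /\ fine (P A) = V A.
Proof.
move=> [[V0 [VT _]] [L [_ LV]]] mA; have [_ [P LP PA]] := LV _ mA.
exists P; split; last by rewrite PA.
split; first by rewrite measure0.
split; first by rewrite probability_setT.
split; first by move=> B mB; exact: fine_prob_ge0.
split; first by move=> B C mB mC BC; exact: fine_probU.
move=> B mB; rewrite -lee_fin fine_probE//.
by have [+ _] := LV _ mB; exact.
Qed.

(** Let [p n] in the compact set attain [V (F n)], and let [P] be a limit of [p] along an
    ultrafilter. For fixed [m] and all [n >= m], [p n] gives [F m] at least the mass [V (F n) >= v],
    so [P (F m) >= v]. Continuity from above of the single measure [P] concludes. *)
Lemma upper_probability_nonincreasing V (F : nat -> set Omega) (v : R) :
  upper_probability V -> (forall n, measurable (F n)) -> nonincreasing_seq F ->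
  (forall n, v <= V (F n)) -> v <= V (\bigcap_n F n).
Proof.
move=> [_ [L [cL LV]]] mF niF vF.
have mI : measurable (\bigcap_n F n) by apply: bigcap_measurable => //.
have /choice[p pP] n : exists P, L P /\ P (F n) = (V (F n))%:E.
  by have [_ [P LP PF]] := LV _ (mF n); exists P.
have [G [GU sG]] := ultraFilterLemma
  (fmap_proper_filter (setwise_eval \o p) (@eventually_filter)).
have GL : G (setwise_eval @` L).
  by apply: sG; exists 0%N => // n _; exists (p n) => //; case: (pP n).
move: cL; rewrite /setwise_compact compact_ultra => /(_ G GU GL)[_ [[P LP <-] /= GP]].
have [+ _] := LV _ mI; move=> /(_ P LP); rewrite -fine_probE// lee_fin.
apply: le_trans; apply: prob_nonincreasing_ge => // m.
have ev : (fun g : {ptws set Omega -> R} => g (F m)) @ G --> setwise_eval P (F m).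
  exact: (@cvg_comp _ _ _ id (fun g : {ptws set Omega -> R} => g (F m)) _ _ _ GP
    (@proj_continuous _ (fun=> R) (F m) (setwise_eval P))).
have -> : fine (P (F m)) = setwise_eval P (F m).
  by rewrite /setwise_eval asboolT.
apply: (closed_cvg (fun x => v <= x)) ev; first exact: closed_ge.
apply: sG; exists m => // n /= mn.
rewrite /setwise_eval asboolT//.
have [_ pFn] := pP n.
apply: (le_trans (vF n)); rewrite -lee_fin -pFn fine_probE//.
by apply: le_measure; rewrite ?inE//; exact/subsetPset/niF.
Qed.

Lemma upper_probability_cvg0 V (F : nat -> set Omega) (e : R) :
  upper_probability V -> (forall n, measurable (F n)) -> nonincreasing_seq F ->
  \bigcap_n F n = set0 -> 0 < e -> exists n, V (F n) < e.
Proof.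
move=> uV mF niF F0 e0; apply/not_existsP => h.
have : e <= V (\bigcap_n F n).
  by apply: upper_probability_nonincreasing => // n; rewrite leNgt; exact/negP.
by rewrite F0; case: uV => -[-> _] _; rewrite leNgt e0.
Qed.

(** * Countable additivity of the elements of the core *)

Section core_measure.
Variables (V P : set Omega -> R) (uV : upper_probability V) (cP : core V P).

(** [P] is arbitrary off the measurable sets, whereas a measure has to be nonnegative on every set;
    hence the default value 0. *)
Definition core_measure A : \bar R := if `[< measurable A >] then (P A)%:E else 0%E.

Lemma core_measureE A : measurable A -> core_measure A = (P A)%:E.
Proof. by move=> mA; rewrite /core_measure asboolT. Qed.

Let core_measure0 : core_measure set0 = 0%E.
Proof. by rewrite core_measureE//; case: cP => ->. Qed.

Let core_measure_ge0 A : (0 <= core_measure A)%E.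
Proof.
rewrite /core_measure; case: asboolP => // mA; rewrite lee_fin.
by case: cP => _ [_ [+ _]]; exact.
Qed.

(** Finite additivity leaves as remainder the mass [P (W n)] of a tail union. It is at most
    [V (W n)], which becomes small because [V] is continuous from above at the empty set. *)
Let core_measure_sigma_additive : semi_sigma_additive core_measure.
Proof.
case: cP => P0 [_ [Pge0 [Padd PV]]] F mF tF mU.
pose W n := \bigcup_(k >= n) F k.
have mW n : measurable (W n) by apply: bigcup_measurable => k _; exact: mF.
have WS n : W n = F n `|` W n.+1.
  apply/seteqP; split => x.
    move=> [k /= nk Fkx]; move: nk; rewrite leq_eqVlt => /predU1P[->|nk]; first by left.
    by right; exists k.
  by move=> [Fx|[k /= nk Fkx]]; [exists n => /=|exists k => //=; exact: ltnW].
have sumE n : P (\bigcup_k F k) = \sum_(0 <= i < n) P (F i) + P (W n).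
  elim: n => [|n ->]; first by rewrite big_geq// add0r /W; congr P; apply: eq_bigcupl.
  rewrite big_nat_recr//= -addrA; congr (_ + _); rewrite [in LHS]WS Padd//.
  rewrite -subset0 => x [Fx [k /= nk Fkx]].
  have : F n `&` F k !=set0 by exists x.
  by move/(tF n k I I) => nk'; rewrite nk' ltnn in nk.
rewrite core_measureE//.
rewrite (_ : (fun n => _) = EFin \o (fun n => \sum_(0 <= i < n) P (F i))); last first.
  apply/funext => n /=; rewrite -sumEFin; apply: eq_bigr => i _; exact: core_measureE.
apply: cvg_EFin; first exact: nearW.
apply/cvgrPdist_le => e e0.
have niW : nonincreasing_seq W.
  move=> m n mn; apply/subsetPset => x [k /= nk Fkx].
  by exists k => //=; exact: leq_trans nk.
have [n0 Wn0] : exists n, V (W n) < e.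
  apply: upper_probability_cvg0 => //.
  rewrite -subset0 => x Wx; have [k _ Fkx] := Wx 0%N I.
  have [j /= kj Fjx] := Wx k.+1 I.
  have /(tF k j I I) kj' : F k `&` F j !=set0 by exists x.
  by rewrite kj' ltnn in kj.
near=> n; rewrite (sumE n) addrC addKr ger0_norm ?Pge0//.
apply: le_trans (ltW Wn0); apply: le_trans (PV _ (mW n)) _.
case: uV => -[_ [_ [_ Vmon]]] _; apply: Vmon => //; apply/subsetPset/niW.
by near: n; exact: nbhs_infty_ge.
Unshelve. all: by end_near. Qed.

HB.instance Definition _ := isMeasure.Build _ _ _ core_measure
  core_measure0 core_measure_ge0 core_measure_sigma_additive.

Let core_measure_setT : core_measure setT = 1%E.
Proof. by rewrite core_measureE//; case: cP => _ [-> _]. Qed.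

HB.instance Definition _ :=
  Measure_isProbability.Build _ _ _ core_measure core_measure_setT.

Lemma core_probability :
  exists P' : probability Omega R, forall A, measurable A -> fine (P' A) = P A.
Proof. by exists core_measure => A mA /=; rewrite core_measureE. Qed.

End core_measure.

(** * Iterates of the map, recurrence and domination *)

Variable T : Omega -> Omega.
Hypothesis mT : measurable_fun setT T.

Lemma measurable_iter k : measurable_fun setT (iter k T).
Proof.
elim: k => [|k ih]; first exact: measurable_id.
exact: (measurableT_comp mT ih).
Qed.

Lemma measurable_preimage_iter k A : measurable A -> measurable (iter k T @^-1` A).
Proof. by move=> mA; rewrite -[X in measurable X]setTI; exact: measurable_iter. Qed.

Lemma preimage_iterS k A : iter k.+1 T @^-1` A = T @^-1` (iter k T @^-1` A).
Proof. by rewrite /preimage; apply/seteqP; split => x /=; rewrite -iterS iterSr. Qed.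

Lemma cap_invariant_iter V k A : cap_invariant T V -> measurable A ->
  V (iter k T @^-1` A) = V A.
Proof.
move=> iV mA; elim: k => [//|k ih].
by rewrite preimage_iterS iV ?ih//; exact: measurable_preimage_iter.
Qed.

Lemma invariant_prob_iter P k A : invariant_prob T P -> measurable A ->
  P (iter k T @^-1` A) = P A.
Proof.
move=> iP mA; elim: k => [//|k ih].
by rewrite preimage_iterS iP ?ih//; exact: measurable_preimage_iter.
Qed.

Definition recurrent_set N := lim_sup_set (fun k => iter k T @^-1` N).

Lemma measurable_recurrent_set N : measurable N -> measurable (recurrent_set N).
Proof.
move=> mN; apply: bigcap_measurable => // k _; apply: bigcup_measurable => j _.
exact: measurable_preimage_iter.
Qed.

Let preimage_tail N n : T @^-1` (\bigcup_(k >= n) (iter k T @^-1` N)) =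
  \bigcup_(k >= n.+1) (iter k T @^-1` N).
Proof.
apply/seteqP; split => x.
  by move=> [k /= nk]; rewrite /preimage/= -iterSr => Nx; exists k.+1.
move=> [[//|k] /= nk Nx]; exists k => //.
by rewrite /preimage/= -iterSr.
Qed.

Lemma recurrent_set_invariant N : T @^-1` (recurrent_set N) = recurrent_set N.
Proof.
apply/seteqP; split => x.
  move=> h n _; have : (T @^-1` (\bigcup_(k >= n) (iter k T @^-1` N))) x := h n I.
  by rewrite preimage_tail; move=> [k /= nk Nx]; exists k => //=; exact: ltnW.
move=> h n _.
suff : (T @^-1` (\bigcup_(k >= n) (iter k T @^-1` N))) x by [].
by rewrite preimage_tail; exact: h n.+1 I.
Qed.

(** The tail unions satisfy [T^-1 (W n) = W n.+1], so by invariance all have the capacity of [W 0],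
    which contains [N]. Continuity from above transfers this to their intersection. *)
Lemma upper_probability_recurrent_set V N : upper_probability V ->
  cap_invariant T V -> measurable N -> V N <= V (recurrent_set N).
Proof.
move=> uV iV mN.
pose W n := \bigcup_(k >= n) (iter k T @^-1` N).
have mW n : measurable (W n).
  by apply: bigcup_measurable => j _; exact: measurable_preimage_iter.
apply: upper_probability_nonincreasing => // [m n mn|n].
  by apply/subsetPset => x [k /= nk Fkx]; exists k => //=; exact: leq_trans nk.
have -> : V (W n) = V (W 0%N).
  by elim: n => // n <-; rewrite -(iV (W n))// /W preimage_tail.
case: uV => -[_ [_ [_ Vmon]]] _; apply: Vmon => // x Nx.
by exists 0%N.
Qed.

Lemma invariant_prob_recurrent_set Q N : invariant_prob T Q -> measurable N ->
  Q N = 0%E -> Q (recurrent_set N) = 0%E.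
Proof.
move=> iQ mN QN.
suff W0 : Q (\bigcup_k (iter k T @^-1` N)) = 0%E.
  apply: subset_measure0 W0 => //; first exact: measurable_recurrent_set.
    by apply: bigcup_measurable => j _; exact: measurable_preimage_iter.
  by move=> x /(_ 0%N I)[k _ Nx]; exists k.
apply/negligibleP; first by apply: bigcup_measurable => j _;
  exact: measurable_preimage_iter.
apply: negligible_bigcup => k; apply/negligibleP; first exact: measurable_preimage_iter.
by rewrite [LHS](invariant_prob_iter k iQ mN).
Qed.


(** Domination need only be tested on invariant sets, because [recurrent_set N] is one and controls
    [N]. Both directions of the equivalence use this reduction. *)
Lemma upper_probability_dominated V Q : upper_probability V -> cap_invariant T V ->
  invariant_prob T Q ->
  (forall A, measurable A -> T @^-1` A = A -> Q A = 0%E -> V A = 0) ->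
  forall N, measurable N -> Q N = 0%E -> V N = 0.
Proof.
move=> uV iV iQ VQ N mN QN; apply/eqP; rewrite eq_le.
have [[_ [_ [V01 _]]] _] := uV.
have /andP[-> _] := V01 _ mN; rewrite andbT.
rewrite (le_trans (upper_probability_recurrent_set uV iV mN))//.
rewrite VQ ?recurrent_set_invariant//; first exact: measurable_recurrent_set.
exact: invariant_prob_recurrent_set.
Qed.

(** A Krylov-Bogoliubov argument: the averages of the images of some [P] in the core under the
    iterates of [T] converge setwise along an ultrafilter. Invariance of [V] keeps the limit below
    [V], and countable additivity then comes for free from [core_probability]. *)
Lemma core_invariant_probability V : upper_probability V -> cap_invariant T V ->
  exists Q, core V (fun A => fine (Q A)) /\ invariant_prob T Q.
Proof.
move=> uV iV.
have [P [cP _]] := upper_probability_core uV measurableT.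
have [_ [_ [_ [_ PV]]]] := cP.
(* One ultrafilter serves all measurable sets at once, so additivity and bounds pass to the limit
   without extracting subsequences. *)
have [G [GU sG]] := ultraFilterLemma eventually_filter.
pose c n A := n%:R^-1 * \sum_(i < n) fine (P (iter i T @^-1` A)).
have mi i A : measurable A -> measurable (iter i T @^-1` A).
  exact: measurable_preimage_iter.
have c01 n A : measurable A -> 0 <= c n A <= 1.
  move=> mA; rewrite /c; apply/andP; split.
    by rewrite mulr_ge0 ?invr_ge0// sumr_ge0// => i _; exact: fine_prob_ge0.
  case: n => [|n]; first by rewrite invr0 mul0r.
  rewrite ler_pdivrMl// mulr1 -[in leRHS](card_ord n.+1) -sumr_const.
  by apply: ler_sum => i _; exact/fine_prob_le1/mi.
have ccvg A : measurable A -> exists l : R, c n A @[n --> G] --> l.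
  move=> mA; have := @segment_compact R 0 1; rewrite compact_ultra.
  move=> /(_ (c n A @[n --> G]) (fmap_ultra _ GU))[|l [_ cl]]; last by exists l.
  by apply: (@filterE _ G) => n /=; rewrite in_itv/=; exact: c01.
pose q A := if `[< measurable A >] then lim (c n A @[n --> G]) else 0.
have qE A : measurable A -> c n A @[n --> G] --> q A.
  by move=> mA; rewrite /q asboolT//; have [l cl] := ccvg _ mA; apply/cvgP: cl.
have ngt0 : \forall n \near G, (0 < n)%N by apply: sG; exists 1%N.
have q_eq A r : measurable A -> (\forall n \near G, c n A = r) -> q A = r.
  move=> mA cr; apply: (@cvg_unique _ (@Rhausdorff R) (c n A @[n --> G])) => //.
    exact: qE.
  by apply: (cvg_trans _ (@cvg_cst _ r _ G _)); apply: near_eq_cvg;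
    apply: filterS cr => n ->.
have cq : core V q.
  split.
    apply: q_eq => //; apply: filterE => n; rewrite /c big1 ?mulr0// => i _.
    by rewrite preimage_set0 measure0.
  split.
    apply: q_eq => //; apply: filterS ngt0 => n n0; rewrite /c.
    under eq_bigr do rewrite preimage_setT probability_setT/=.
    by rewrite sumr_const card_ord mulVf// pnatr_eq0 -lt0n.
  split.
    move=> A mA; apply: (@closed_cvg _ R G _ (c^~ A) (fun x =>
      0 <= x) _ _ _ (qE _ mA)); first exact: closed_ge.
    by apply: filterE => n; have /andP[] := c01 n _ mA.
  split.
    move=> A B mA mB AB.
    apply: (@cvg_unique _ (@Rhausdorff R) (c n (A `|` B) @[n --> G])) => //.
      by apply: qE; exact: measurableU.
    rewrite (_ : (fun n => _) = (fun n => c n A + c n B)).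
      by apply: cvgD; exact: qE.
    apply/funext => n; rewrite /c -mulrDr -big_split/=; congr (_ * _).
    apply: eq_bigr => i _; rewrite preimage_setU fine_probU//; [exact: mi|exact: mi|].
    by rewrite -preimage_setI AB preimage_set0.
  move=> A mA; apply: (@closed_cvg _ R G _ (c^~ A) (fun x =>
    x <= V A) _ _ _ (qE _ mA)); first exact: closed_le.
  apply: filterS ngt0 => n n0; rewrite /c ler_pdivrMl ?ltr0n//.
  rewrite -[n in n%:R * _]card_ord mulr_natl -sumr_const.
  apply: ler_sum => i _; rewrite -(cap_invariant_iter i iV mA).
  exact/PV/mi.
have [Q QE] := core_probability uV cq.
exists Q; split.
  case: cq => q0 [q1 [qge0 [qadd qV]]].
  split; first by rewrite measure0.
  split; first by rewrite probability_setT.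
  split; first by move=> B mB; exact: fine_prob_ge0.
  split; first by move=> B C mB mC BC; exact: fine_probU.
  by move=> B mB; rewrite QE//; exact: qV.
move=> A mA; have mTA : measurable (T @^-1` A) by exact: (mi 1%N).
rewrite -fine_probE// -[RHS]fine_probE// !QE//; congr (_%:E).
apply/eqP; rewrite -subr_eq0; apply/eqP.
apply: (@cvg_unique _ (@Rhausdorff R) (c n (T @^-1` A) - c n A @[n --> G])) => //.
  by apply: cvgB; exact: qE.
(* The difference of the two averages telescopes to a boundary term of size at most 1/n. *)
have cE n : c n (T @^-1` A) - c n A =
    n%:R^-1 * (fine (P (iter n T @^-1` A)) - fine (P A)).
  rewrite /c -mulrBr; congr (_ * _).
  rewrite -sumrB (eq_bigr (fun i : 'I_n => fine (P (iter i.+1 T @^-1` A)) -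
    fine (P (iter i T @^-1` A)))).
    by rewrite -(big_mkord xpredT (fun i => fine (P (iter i.+1 T @^-1` A)) -
      fine (P (iter i T @^-1` A)))) telescope_sumr.
  by move=> i _; congr (fine (P _) - _); rewrite preimage_iterS; apply/seteqP; split =>
    x /=; rewrite /preimage/= -iterS iterSr.
suff L : n%:R^-1 * (fine (P (iter n T @^-1` A)) - fine (P A)) @[n --> \oo] --> (0 : R).
  rewrite (_ : (fun n => _) = (fun n => n%:R^-1 * (fine (P (iter n T @^-1` A)) -
    fine (P A)))).
    by move=> S /L hS; apply: sG; exact: hS.
  exact/funext.
apply/norm_cvg0P.
apply: (@squeeze_cvgr _ _ _ _ (cst 0) (fun n => n%:R^-1)).
- apply: nearW => n; rewrite normr_ge0/= normrM ger0_norm ?invr_ge0//.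
  rewrite ler_piMr ?invr_ge0// ler_norml.
  have := fine_prob_le1 P mA; have := fine_prob_le1 P (mi n _ mA).
  have := fine_prob_ge0 P A; have := fine_prob_ge0 P (iter n T @^-1` A).
  by move=> *; apply/andP; split; lra.
- exact: cvg_cst.
- exact: cvg_invn.
Unshelve. all: by end_near. Qed.

End upper_probability.

(** * Parseval inequality for Toeplitz matrices *)

Section toeplitz.
Context {R : realType}.

Lemma sin_natpi n : sin (n%:R * pi) = 0 :> R.
Proof.
elim: n => [|n ih]; first by rewrite mul0r sin0.
by rewrite -natr1 mulrDl mul1r sinD ih sinpi mul0r mulr0 addr0.
Qed.

(** Orthogonality of the characters of Z/M, in real form. For [u != v] the sum is multiplied by
    [2 sin a], where [a = (u - v) pi / M], which makes it telescope. *)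
Lemma sum_cos_circle (M u v : nat) : (u < M)%N -> (v < M)%N ->
  \sum_(j < M) cos ((u%:R - v%:R) * (2 * pi * j%:R / M%:R)) =
  M%:R * (u == v)%:R :> R.
Proof.
move=> uM vM; have M0 : (0 < M)%N by exact: leq_ltn_trans uM.
have M0' : M%:R != 0 :> R by rewrite pnatr_eq0 -lt0n.
have [->|uv] := eqVneq u v.
  under eq_bigr do rewrite subrr mul0r cos0.
  by rewrite sumr_const card_ord mulr1.
rewrite mulr0; set a : R := (u%:R - v%:R) * pi / M%:R.
have sin_aM : sin (a * M%:R) = 0.
  by rewrite /a divfK// mulrBl sinB !sin_natpi mul0r mulr0 subrr.
(* Here [0 < |u - v| < M], so [a] lies strictly between 0 and [pi] in absolute value. *)
have sin_a : sin a != 0.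
  have small n m : (n < M)%N -> (m < n)%N -> 0 < sin ((n%:R - m%:R) * pi / M%:R : R).
    move=> nM mn; apply: sin_gt0_pi; apply/andP; split.
      by rewrite divr_gt0 ?ltr0n// mulr_gt0 ?pi_gt0// subr_gt0 ltr_nat.
    rewrite ltr_pdivrMr ?ltr0n// mulrC ltr_pM2l ?pi_gt0// -natrB 1?ltnW// ltr_nat.
    by rewrite (leq_ltn_trans (leq_subr _ _)).
  have [vu|uv'|/eqP] := ltngtP v u; last by rewrite eq_sym (negbTE uv).
    by rewrite gt_eqF// small.
  by rewrite /a -opprB !mulNr sinN oppr_eq0 gt_eqF// small.
apply: (mulfI (mulf_neq0 (_ : 2%:R != 0) sin_a)); first by rewrite pnatr_eq0.
rewrite mulr0 mulr_sumr.
(* [2 sin a cos (2 a j) = F j.+1 - F j], and [F M = F 0] because [sin (a M) = 0]. *)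
pose F j : R := sin (a * (2 * j%:R - 1)).
rewrite (eq_bigr (fun j : 'I_M => F j.+1 - F j)).
  rewrite -(big_mkord xpredT (fun j => F j.+1 - F j)) telescope_sumr// /F.
  rewrite mulr0 sub0r mulrN1 sinN opprK mulrBr mulr1 sinB.
  have -> : a * (2 * M%:R) = (a * M%:R) *+ 2 by ring.
  rewrite sin_mulr2n cos_mulr2n cos2sin2 sin_aM mulr0 mul0rn mul0r expr0n/= subr0.
  ring.
move=> j _; rewrite /F.
have -> : (u%:R - v%:R) * (2 * pi * j%:R / M%:R) = a * (2 * j%:R) by rewrite /a; ring.
have -> : a * (2 * j.+1%:R - 1) = a * (2 * j%:R) + a by rewrite -natr1; ring.
have -> : a * (2 * j%:R - 1) = a * (2 * j%:R) - a by ring.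
rewrite sinD sinB; ring.
Qed.

Variable b : nat -> nat -> R.
Hypothesis b_shift : forall i j k, b (i + k) (j + k) = b i j.
Hypothesis b_sym : forall i j, b i j = b j i.

(** The Hermitian form of the matrix [b] at the vector of the e^(int), n < N; since [b] is symmetric
    only the cosines remain. *)
Definition toeplitz_form (N : nat) (t : R) : R :=
  \sum_(i < N) \sum_(j < N) b i j * cos ((i%:R - j%:R) * t).

(** Entries depend on the difference of the indices only; the equation is written with sums to avoid
    truncated subtraction. *)
Let b_diag n m n' m' : (n' + m = m' + n)%N -> b n' m' = b n m.
Proof.
move=> e; rewrite -(b_shift n' m' m) -(b_shift n m m'); congr b; last by rewrite addnC.
by rewrite e addnC.
Qed.

Let circle (M j : nat) : R := 2 * pi * j%:R / M%:R.

Lemma mean_toeplitz_form K M : (K <= M)%N ->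
  \sum_(l < M) toeplitz_form K (circle M l) = M%:R * (K%:R * b 0 0).
Proof.
move=> KM; rewrite /toeplitz_form exchange_big/=.
under eq_bigr do rewrite exchange_big/=.
rewrite (eq_bigr (fun=> M%:R * b 0 0)).
  by rewrite sumr_const card_ord -mulr_natl; ring.
move=> i _.
rewrite (eq_bigr (fun j : 'I_K => b i j * (M%:R * (i == j :> nat)%:R))); last first.
  by move=> j _; rewrite -mulr_sumr sum_cos_circle//; apply: leq_trans KM.
rewrite (bigD1 i)//= eqxx big1 ?addr0.
  by rewrite -(b_shift 0 0 i) add0n mulr1 mulrC.
by move=> j ji; rewrite (_ : (i == j :> nat) = false) ?mulr0//; apply/negbTE;
  rewrite eq_sym.
Qed.

(* Parseval on the circle of [M = 4N] equidistant points: each diagonal of the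
   [N x N] matrix meets at least [N] entries of the same diagonal in the
   [3N x 3N] one. *)
Lemma toeplitz_sum_sqr_le N (s : R) : (0 < N)%N ->
  (forall t, 0 <= toeplitz_form (3 * N) t) ->
  (forall l, (l < 4 * N)%N -> toeplitz_form N (circle (4 * N) l) <= s) ->
  \sum_(i < N) \sum_(j < N) b i j ^+ 2 <= 6 * b 0 0 * s.
Proof.
move=> N0 phi0 phis; set M := (4 * N)%N; set K := (3 * N)%N.
have M0 : 0 < M%:R :> R by rewrite ltr0n muln_gt0.
(* Counts the coincidences of the diagonal through [p] with the diagonal through [n] and with its
   transpose. *)
pose kap (p n : nat * nat) : R :=
  ((p.1 + n.1)%N == (p.2 + n.2)%N)%:R + ((p.1 + n.2)%N == (p.2 + n.1)%N)%:R.
(* The product of cosines is half the sum of two cosines, whose frequencies are differences of sums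
   of indices. These sums stay below 3N + N = M, so there is no aliasing. *)
have orth (n' m' n m : nat) : (n' < K)%N -> (m' < K)%N -> (n < N)%N -> (m < N)%N ->
    \sum_(l < M) cos ((n'%:R - m'%:R) * circle M l) * cos ((n%:R - m%:R) * circle M l)
    = M%:R / 2 * kap (n', m') (n, m).
  move=> n'K m'K nN mN.
  rewrite (eq_bigr (fun l : 'I_M => 2^-1 *
     (cos (((n' + n)%:R - (m' + m)%:R) * circle M l) +
      cos (((n' + m)%:R - (m' + n)%:R) * circle M l)))).
    rewrite -mulr_sumr big_split/= !sum_cos_circle; rewrite ?/M ?/K in n'K m'K *; try lia.
    by rewrite /kap /=; ring.
  move=> l _; set x := (_ - _) * _; set y := (_ - _) * _.
  have -> : ((n' + n)%:R - (m' + m)%:R) * circle M l = x + y by rewrite /x /y !natrD;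
    ring.
  have -> : ((n' + m)%:R - (m' + n)%:R) * circle M l = x - y by rewrite /x /y !natrD;
    ring.
  by rewrite cosD cosB; field.
have lower : M%:R / 2 * N%:R * (\sum_(i < N) \sum_(j < N) b i j ^+ 2) <=
    \sum_(l < M) toeplitz_form K (circle M l) * toeplitz_form N (circle M l).
  have -> : \sum_(l < M) toeplitz_form K (circle M l) * toeplitz_form N (circle M l) =
      \sum_(n < N) \sum_(m < N) \sum_(n' < K) \sum_(m' < K)
        b n' m' * b n m * (M%:R / 2 * kap (n' : nat, m' : nat) (n : nat, m : nat)).
    transitivity (\sum_(l < M) \sum_(n < N) \sum_(m < N) \sum_(n' < K) \sum_(m' < K)
        b n' m' * b n m * (cos ((n'%:R - m'%:R) * circle M l) * cos ((n%:R -
          m%:R) * circle M l))).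
      apply: eq_bigr => l _; rewrite /toeplitz_form mulrC mulr_suml; apply: eq_bigr =>
        n _.
      rewrite mulr_suml; apply: eq_bigr => m _.
      rewrite mulr_sumr; apply: eq_bigr => n' _.
      by rewrite mulr_sumr; apply: eq_bigr => m' _; ring.
    rewrite exchange_big/=; apply: eq_bigr => n _.
    rewrite exchange_big/=; apply: eq_bigr => m _.
    rewrite exchange_big/=; apply: eq_bigr => n' _.
    rewrite exchange_big/=; apply: eq_bigr => m' _.
    by rewrite -mulr_sumr orth.
  rewrite mulr_sumr; apply: ler_sum => n _.
  rewrite mulr_sumr; apply: ler_sum => m _.
  (* Only the N rows with [N <= n' < 2N] are kept: there [m' = n' + m - n] is a genuine index below
     3N, whatever [n, m < N] are. *)
  have -> : M%:R / 2 * N%:R * b n m ^+ 2 =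
      \sum_(n' < K | (N <= n' < 2 * N)%N) (M%:R / 2 * b n m ^+ 2).
    rewrite sumr_const.
    rewrite (_ : #|_| = N); first by rewrite -mulr_natl; ring.
    rewrite -sum1_card.
    rewrite (eq_bigl (fun i : 'I_K => (N <= i < 2 * N)%N)); last by [].
    rewrite -(big_mkord (fun i => (N <= i < 2 * N)%N) (fun=> 1%N)).
    rewrite (big_cat_nat (n := N))//=; last by rewrite /K; lia.
    rewrite big_nat_cond big1 ?add0n; last by move=> i; lia.
    rewrite (big_cat_nat (n := (2 * N)%N))//=; [|lia|rewrite /K; lia].
    rewrite [X in (_ + X)%N]big_nat_cond [X in (_ + X)%N]big1 ?addn0; last by move=> i;
      lia.
    rewrite big_nat_cond (eq_bigl (fun i => (N <= i < 2 * N)%N)); last by move=> i;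
      rewrite andbb.
    by rewrite -big_nat sum_nat_const_nat; lia.
  (* Where [kap] does not vanish, [b n' m'] equals [b n m], so each term is a multiple of a square
     and the remaining terms may be dropped. *)
  have term_ge0 (n' m' : nat) :
      0 <= b n' m' * b n m * (M%:R / 2 * kap (n', m') (n : nat, m : nat)).
    rewrite /kap /=; case: eqP => [e|_]; case: eqP => [e'|_].
    - by rewrite (b_diag e') -expr2 mulr_ge0 ?sqr_ge0 ?mulr_ge0 ?invr_ge0 ?(ltW M0).
    - by rewrite (b_diag e) b_sym -expr2 mulr_ge0 ?sqr_ge0 ?mulr_ge0 ?invr_ge0 ?(ltW M0) ?addr_ge0.
    - by rewrite (b_diag e') -expr2 mulr_ge0 ?sqr_ge0 ?mulr_ge0 ?invr_ge0 ?(ltW M0) ?addr_ge0.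
    - by rewrite addr0 !mulr0.
  rewrite [leRHS](bigID (fun n' : 'I_K => (N <= n' < 2 * N)%N))/=.
  rewrite -[leLHS]addr0 lerD//; last by apply: sumr_ge0 => n' _; apply: sumr_ge0.
  apply: ler_sum => n' /andP[Nn' n'N].
  have m'K : (n' + m - n < K)%N 
    by move: (ltn_ord n) (ltn_ord m) n'N Nn'; rewrite /K;
      move: (nat_of_ord n) (nat_of_ord m) (nat_of_ord n') => ? ? ? ? ? ? ?; lia.
  rewrite (bigD1 (Ordinal m'K))//= -[leLHS]addr0 lerD//; last exact: sumr_ge0.
  have e : (n' + m = (n' + m - n) + n)%N 
    by move: (ltn_ord n) Nn'; move: (nat_of_ord n) (nat_of_ord m) (nat_of_ord n') =>
      ? ? ? ? ?; lia.
  rewrite (b_diag e) -expr2 mulrC ler_wpM2l ?sqr_ge0//.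
  rewrite -[leLHS]mulr1 ler_wpM2l ?mulr_ge0 ?invr_ge0 ?(ltW M0)//.
  by rewrite /kap /= -e eqxx lerDr.
(* Nonnegativity of the larger form lets the smaller one be replaced by its bound [s]; the mean of
   the larger form is known. The final constant is [2K / N = 6]. *)
have upper : \sum_(l < M) toeplitz_form K (circle M l) * toeplitz_form N (circle M l) <=
    M%:R * (K%:R * b 0 0) * s.
  rewrite -mean_toeplitz_form; last by rewrite /K /M; lia.
  rewrite mulr_suml; apply: ler_sum => l _.
  by rewrite ler_wpM2l// phis.
have := le_trans lower upper.
have -> : M%:R * (K%:R * b 0 0) * s = M%:R / 2 * N%:R * (6 * b 0 0 * s).
  by rewrite /K natrM; field.
by rewrite ler_pM2l// !mulr_gt0 ?invr_gt0// ltr0n.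
Qed.

End toeplitz.

(** * Polynomials as weights on a sequence *)

Section coef_sum.
Context {R : realType}.
Implicit Types (u v : nat -> R) (p q : {poly R}).

(** The linear functional on polynomials sending ['X^i] to [u i]. Multiplication by ['X] becomes the
    shift of [u], so identities between weighted averages along an orbit reduce to polynomial
    identities. *)
Definition coef_sum u p := \sum_(i < size p) p`_i * u i.

Lemma coef_sum_widen u p N : (size p <= N)%N ->
  coef_sum u p = \sum_(i < N) p`_i * u i.
Proof.
move=> pN; rewrite /coef_sum (big_ord_widen N (fun i => p`_i * u i) pN) big_mkcond.
by apply: eq_bigr => i _; case: ltnP => // ip; rewrite nth_default// mul0r.
Qed.

Lemma coef_sumD u p q : coef_sum u (p + q) = coef_sum u p + coef_sum u q.
Proof.
pose N := maxn (size p) (size q).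
rewrite !(@coef_sum_widen _ _ N) ?leq_maxl ?leq_maxr ?size_polyD// -big_split/=.
by apply: eq_bigr => i _; rewrite coefD mulrDl.
Qed.

Lemma coef_sumZ u c p : coef_sum u (c *: p) = c * coef_sum u p.
Proof.
rewrite !(@coef_sum_widen _ _ (size p)) ?size_scale_leq// mulr_sumr.
by apply: eq_bigr => i _; rewrite coefZ mulrA.
Qed.

Lemma coef_sumB u p q : coef_sum u (p - q) = coef_sum u p - coef_sum u q.
Proof. by rewrite coef_sumD -[- q]scaleN1r coef_sumZ mulN1r. Qed.

Lemma coef_sumXM u p : coef_sum u ('X * p) = coef_sum (fun i => u i.+1) p.
Proof.
rewrite (@coef_sum_widen _ _ (size p).+1).
  rewrite big_ord_recl coefXM/= mul0r add0r; apply: eq_bigr => i _.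
  by rewrite coefXM.
by rewrite (leq_trans (size_polyMleq _ _))// size_polyX.
Qed.

Lemma coef_sum_lin a c u v p :
  coef_sum (fun i => a * u i + c * v i) p = a * coef_sum u p + c * coef_sum v p.
Proof.
rewrite /coef_sum !mulr_sumr -big_split/=; apply: eq_bigr => i _; ring.
Qed.

Definition cesaro_poly N : {poly R} := \poly_(i < N) N%:R^-1.

Lemma coef_sum_cesaro u N : coef_sum u (cesaro_poly N) = N%:R^-1 * \sum_(i < N) u i.
Proof.
rewrite (@coef_sum_widen _ _ N) ?size_poly// mulr_sumr.
by apply: eq_bigr => i _; rewrite coef_poly ltn_ord.
Qed.

Lemma cesaro_polyE N : cesaro_poly N = N%:R^-1 *: \sum_(i < N) 'X^i.
Proof. by rewrite /cesaro_poly poly_def scaler_sumr. Qed.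

Lemma cesaro_poly_subX1 N : ('X - 1) * cesaro_poly N = N%:R^-1 *: ('X^N - 1).
Proof. by rewrite cesaro_polyE -scalerAr -subrX1. Qed.

Lemma cesaro_poly1 N : (0 < N)%N -> (cesaro_poly N).[1] = 1.
Proof.
move=> N0; rewrite cesaro_polyE hornerZ horner_sum.
under eq_bigr do rewrite hornerXn expr1n.
by rewrite sumr_const card_ord mulVf// pnatr_eq0 -lt0n.
Qed.

End coef_sum.

Lemma cvg_geometric_increments (R : realType) (u : nat -> R) (n0 : nat) :
  (forall n, (n0 <= n)%N -> `|u n - u n.+1| <= 2^-1 ^+ n) -> cvgn u.
Proof.
move=> un; pose w n := u (n + n0)%N.
suff : cvgn w by move=> /cvg_ex[l wl]; apply/cvg_ex; exists l; rewrite -(cvg_shiftn n0).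
pose dw n := w n.+1 - w n.
have sE n : series dw n = w n - w 0%N by rewrite /series/= telescope_sumr.
have : cvgn (series dw).
  apply: normed_cvg; apply: (@series_le_cvg _ _ (fun n => 2^-1 ^+ n)) => //.
  - by move=> n /=; exact: normr_ge0.
  - move=> n; rewrite [leLHS](_ : _ = `|u (n + n0)%N - u (n + n0).+1|);
    last by rewrite distrC.
    rewrite (le_trans (un _ (leq_addl _ _)))//.
    by rewrite exprD ler_piMr ?exprn_ge0 ?invr_ge0// exprn_ile1 ?invr_ge0// invf_le1//
      ler1n.
  - rewrite (_ : GRing.exp 2^-1 = geometric 1 2^-1); last by apply/funext => n /=;
    rewrite mul1r.
    apply: is_cvg_geometric_series.
    by rewrite ger0_norm ?invr_ge0// invf_lt1// ltr1n.
move=> /cvg_ex[l sl]; apply/cvg_ex; exists (l + u n0).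
have -> : w = (fun n => series dw n + u n0) by apply/funext => n; rewrite sE subrK.
by apply: cvgD; [exact: sl|exact: cvg_cst].
Qed.

(** * Rotated ergodic averages and decay of correlations *)

Section spectral.
Context {d : measure_display} {Omega : measurableType d} {R : realType}.
Variables (Q : probability Omega R) (T : Omega -> Omega).
Hypotheses (mT : measurable_fun setT T) (iQ : invariant_prob T Q).

Local Notation "''E' f" := (Rintegral Q setT f) (at level 10, f at level 8).

Lemma expect_comp g : bounded_mfun g -> 'E (fun x => g (T x)) = 'E g.
Proof.
move=> bg; rewrite /Rintegral; congr fine.
have bgT := bounded_mfun_comp mT bg.
have := @integral_pushforward _ _ _ _ R T mT Q setT (EFin \o g).
rewrite preimage_setT => <- //.
- apply: eq_measure_integral => A mA _; exact: iQ.
- by apply/measurable_EFinP; case: bg.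
- exact: bounded_mfun_integrable.
Qed.

Lemma bounded_mfun_iter k (g : Omega -> R) : bounded_mfun g -> bounded_mfun (fun x =>
  g (iter k T x)).
Proof. exact/bounded_mfun_comp/measurable_iter. Qed.

Lemma expect_iter k g : bounded_mfun g -> 'E (fun x => g (iter k T x)) = 'E g.
Proof.
move=> bg; elim: k => // k ih.
under eq_Rintegral do rewrite iterSr.
rewrite (@expect_comp (fun x => g (iter k T x)))//.
exact: bounded_mfun_iter.
Qed.

Variable f : Omega -> R.
Hypotheses (mf : measurable_fun setT f) (f1 : forall x, `|f x| <= 1).

Let bf : bounded_mfun f. Proof. by split => //; exists 1. Qed.

Definition autocorrelation i j := 'E (fun x => f (iter i T x) * f (iter j T x)).
Local Notation b := autocorrelation.

Lemma autocorrelation_shift i j k : b (i + k) (j + k) = b i j.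
Proof.
rewrite /b -(@expect_iter k (fun x => f (iter i T x) * f (iter j T x))).
  by apply: eq_Rintegral => x _; rewrite !iterD.
by apply: bounded_mfunM; exact: bounded_mfun_iter.
Qed.

Lemma autocorrelation_sym i j : b i j = b j i.
Proof. by apply: eq_Rintegral => x _; rewrite mulrC. Qed.

Lemma autocorrelation00_le1 : b 0 0 <= 1.
Proof.
rewrite -[leRHS](expect_cst Q); apply: expect_le => [||x].
- exact: bounded_mfunM.
- exact: bounded_mfun_cst.
- by rewrite /= -expr2 -(real_normK (num_real _)) expr_le1.
Qed.

(* Real and imaginary part of [sum_n p_n e^(int) f o T^n]. *)
Definition cos_part (t : R) (p : {poly R}) x :=
  coef_sum (fun i => cos (i%:R * t) * f (iter i T x)) p.
Definition sin_part (t : R) (p : {poly R}) x :=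
  coef_sum (fun i => sin (i%:R * t) * f (iter i T x)) p.
(** The squared L^2 norm of p(e^(it) U) f, where U g = g o T is the Koopman operator. *)
Definition energy t p := 'E (fun x => cos_part t p x ^+ 2 + sin_part t p x ^+ 2).

Lemma bounded_cos_part t p : bounded_mfun (cos_part t p).
Proof.
apply: bounded_mfun_sum => i; apply: bounded_mfunZ; apply: bounded_mfunZ.
exact: bounded_mfun_iter.
Qed.

Lemma bounded_sin_part t p : bounded_mfun (sin_part t p).
Proof.
apply: bounded_mfun_sum => i; apply: bounded_mfunZ; apply: bounded_mfunZ.
exact: bounded_mfun_iter.
Qed.

Lemma bounded_energy t p :
  bounded_mfun (fun x => cos_part t p x ^+ 2 + sin_part t p x ^+ 2).
Proof.
by apply: bounded_mfunD; apply: bounded_mfunX;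
  [exact: bounded_cos_part|exact: bounded_sin_part].
Qed.

Lemma cos_partXM t p x :
  cos_part t ('X * p) x = cos t * cos_part t p (T x) - sin t * sin_part t p (T x).
Proof.
rewrite /cos_part coef_sumXM /sin_part -mulNr -coef_sum_lin; congr coef_sum.
by apply/funext => i; rewrite iterSr -natr1 mulrDl mul1r cosD; ring.
Qed.

Lemma sin_partXM t p x :
  sin_part t ('X * p) x = sin t * cos_part t p (T x) + cos t * sin_part t p (T x).
Proof.
rewrite /sin_part coef_sumXM /cos_part -coef_sum_lin; congr coef_sum.
by apply/funext => i; rewrite iterSr -natr1 mulrDl mul1r sinD; ring.
Qed.

Lemma energy_ge0 t p : 0 <= energy t p.
Proof. by apply: expect_ge0 => x; rewrite addr_ge0 ?sqr_ge0. Qed.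

(** The operator e^(it) U is an isometry: composition with [T] preserves expectations, and the
    rotation by [t] preserves the sum of the two squares. *)
Lemma energyXM t p : energy t ('X * p) = energy t p.
Proof.
rewrite /energy -(expect_comp (bounded_energy t p)); apply: eq_Rintegral => x _.
rewrite cos_partXM sin_partXM.
have := cos2Dsin2 t; move: (cos t) (sin t) (cos_part _ _ _) (sin_part _ _ _) => c s X Y h.
transitivity ((c ^+ 2 + s ^+ 2) * (X ^+ 2 + Y ^+ 2)); first by ring.
by rewrite h mul1r.
Qed.

Lemma energyXnM t n p : energy t ('X^n * p) = energy t p.
Proof.
elim: n => [|n ih]; first by rewrite expr0 mul1r.
by rewrite exprS -mulrA energyXM ih.
Qed.

Lemma energyZ t c p : energy t (c *: p) = c ^+ 2 * energy t p.
Proof.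
rewrite /energy -(expectZ Q _ (bounded_energy t p)); apply: eq_Rintegral => x _.
by rewrite /cos_part /sin_part !coef_sumZ; ring.
Qed.

Lemma energyN t p : energy t (- p) = energy t p.
Proof. by rewrite -scaleN1r energyZ sqrrN expr1n mul1r. Qed.

(** A weighted substitute for the triangle inequality. The free parameter [e] keeps the coefficient
    of the main term as close to 1 as needed, at the expense of the error term. *)
Lemma energyD_le t e p r : 0 < e ->
  energy t (p + r) <= (1 + e) * energy t p + (1 + e^-1) * energy t r.
Proof.
move=> e0; rewrite /energy -!(expectZ Q _ (bounded_energy t _)) -expectD;
  [|exact/bounded_mfunZ/bounded_energy|exact/bounded_mfunZ/bounded_energy].
apply: expect_le => [||x]; first exact: bounded_energy.
  by apply: bounded_mfunD; exact/bounded_mfunZ/bounded_energy.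
rewrite /cos_part /sin_part !coef_sumD.
set X := coef_sum _ p; set Y := coef_sum _ r; set Z := coef_sum _ p;
  set W := coef_sum _ r.
have sq (a c : R) : (a + c) ^+ 2 <= (1 + e) * a ^+ 2 + (1 + e^-1) * c ^+ 2.
  have -> : (1 + e) * a ^+ 2 + (1 + e^-1) * c ^+ 2 =
      (a + c) ^+ 2 + e^-1 * (e * a - c) ^+ 2 by field; rewrite gt_eqF.
  by rewrite lerDl mulr_ge0 ?sqr_ge0// invr_ge0 ltW.
by have := sq X Y; have := sq Z W; lra.
Qed.

Lemma energy_parallelogram t p r :
  energy t (p + r) + energy t (p - r) = 2 * energy t p + 2 * energy t r.
Proof.
rewrite /energy -!(expectZ Q _ (bounded_energy t _)) -!expectD;
  try exact: bounded_energy; try exact/bounded_mfunZ/bounded_energy.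
apply: eq_Rintegral => x _; rewrite /cos_part /sin_part -scaleN1r !coef_sumD !coef_sumZ.
ring.
Qed.

Lemma energy_sum_le t (c : R) (F : nat -> {poly R}) N :
  (forall i, energy t (F i) <= c) -> energy t (\sum_(i < N) F i) <= N%:R ^+ 2 * c.
Proof.
move=> Fc; elim: N => [|[|N] ih].
- rewrite big_ord0 -(scale0r 0) energyZ; lra.
- by rewrite big_ord_recr big_ord0/= add0r expr1n mul1r.
rewrite big_ord_recr/=.
(* With n = [N.+1] summands so far, the weight 1/n makes the constants add up exactly: (1 + 1/n) n^2
   + (1 + n) = (n + 1)^2. *)
have N0 : 0 < N.+1%:R^-1 :> R by rewrite invr_gt0.
apply: le_trans (energyD_le _ _ _ N0) _; rewrite invrK.
have := Fc N.+1; move: ih; set X := energy _ _; set Y := energy _ _ => ih Yc.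
apply: (@le_trans _ _ ((1 + N.+1%:R^-1) * (N.+1%:R ^+ 2 * c) + (1 + N.+1%:R) * c)).
  by apply: lerD; rewrite ler_wpM2l// addr_ge0// ltW.
rewrite -[N.+2%:R]natr1 le_eqVlt; apply/orP; left; apply/eqP; field.
by rewrite addrC natr1 pnatr_eq0.
Qed.

Lemma energy_cesaroM_le t N p : (0 < N)%N -> energy t (cesaro_poly N * p) <= energy t p.
Proof.
move=> N0; rewrite cesaro_polyE -scalerAl mulr_suml energyZ.
have le_p i : energy t ('X^i * p) <= energy t p by rewrite energyXnM.
have := @energy_sum_le t (energy t p) (fun i => 'X^i * p) N le_p.
have N0' : 0 < N%:R ^+ 2 :> R by rewrite exprn_gt0// ltr0n.
by rewrite exprVn ler_pdivrMl.
Qed.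

(** As [1 - p] vanishes at 1, it is a multiple [r * ('X - 1)], and [cesaro_poly N] times ['X - 1] is
    [('X^N - 1) / N]. So up to an error of order N^-2 the averages do no worse than [p]. The
    cofactor [r] depends neither on the angle nor on [N], which later gives uniformity. *)
Lemma energy_cesaro_le (p : {poly R}) : p.[1] = 1 -> exists r, forall s e N,
  0 < e -> (0 < N)%N ->
  energy s (cesaro_poly N) <= (1 + e) * energy s p + (1 +
    e^-1) * (4 * energy s r / N%:R ^+ 2).
Proof.
move=> p1; have /factor_theorem[r rE] : root (1 - p) 1.
  by rewrite rootE !hornerE p1 subrr.
exists r => s e N e0 N0.
have -> : cesaro_poly N = cesaro_poly N * p + cesaro_poly N * (1 - p).
  by rewrite -mulrDr addrC subrK mulr1.
apply: le_trans (energyD_le _ _ _ e0) _; apply: lerD.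
  by rewrite ler_wpM2l ?energy_cesaroM_le// addr_ge0// ltW.
rewrite ler_wpM2l ?addr_ge0 ?invr_ge0 ?(ltW e0)//.
rewrite rE mulrCA [cesaro_poly N * _]mulrC polyC1 cesaro_poly_subX1 -scalerAr energyZ.
rewrite exprVn mulrC ler_wpM2r ?invr_ge0 ?exprn_ge0//.
rewrite mulrC mulrBl mul1r (le_trans (@energyD_le _ 1 _ _ _))//.
by rewrite energyN energyXnM invr1; lra.
Qed.

(** The expanded square is a trigonometric polynomial in [t]: this yields continuity in the angle
    and, for the Cesaro polynomials, the Toeplitz form. *)
Lemma energyE t (p : {poly R}) N : (size p <= N)%N -> energy t p =
  \sum_(i < N) \sum_(j < N) p`_i * p`_j * b i j * cos ((i%:R - j%:R) * t).
Proof.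
move=> pN; rewrite /energy.
transitivity ('E (fun x => \sum_(i < N) \sum_(j < N)
    (p`_i * p`_j * cos ((i%:R - j%:R) * t)) * (f (iter i T x) * f (iter j T x)))).
  apply: eq_Rintegral => x _; rewrite /cos_part /sin_part !(coef_sum_widen _ pN) !expr2.
  rewrite !mulr_suml -big_split/=; apply: eq_bigr => i _.
  rewrite !mulr_sumr -big_split/=; apply: eq_bigr => j _.
  by rewrite [(i%:R - j%:R) * t]mulrBl cosB; ring.
have bb i j : bounded_mfun (fun x => f (iter i T x) * f (iter j T x)).
  by apply: bounded_mfunM; exact: bounded_mfun_iter.
rewrite expect_sum; last first.
  by move=> i; apply: bounded_mfun_sum => j; exact: bounded_mfunZ.
apply: eq_bigr => i _; rewrite expect_sum; last by move=> j; exact: bounded_mfunZ.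
apply: eq_bigr => j _; rewrite expectZ// /b; ring.
Qed.

Lemma continuous_energy p : continuous (energy ^~ p).
Proof.
have -> : energy ^~ p = (fun t => \sum_(i < size p) \sum_(j < size p)
    p`_i * p`_j * b i j * cos ((i%:R - j%:R) * t)).
  by apply/funext => t; exact: energyE.
move=> t; apply: cvg_big => [|i _]; first exact: add_continuous.
apply: cvg_big => [|j _]; first exact: add_continuous.
apply: cvgMl_tmp.
apply: (@cvg_comp _ _ _ (fun t => (i%:R - j%:R) * t) (@cos R));
  last exact: continuous_cos.
exact: mulrl_continuous.
Qed.

Lemma energy_cesaro t N : (0 < N)%N ->
  toeplitz_form b N t = N%:R ^+ 2 * energy t (cesaro_poly N).
Proof.
move=> N0; rewrite (@energyE _ _ N) ?size_poly// mulr_sumr; apply: eq_bigr => i _.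
rewrite mulr_sumr; apply: eq_bigr => j _; rewrite !coef_poly !ltn_ord; field.
by rewrite pnatr_eq0 -lt0n.
Qed.


(* [F + iG] is an eigenfunction with eigenvalue [e^(-it)]. *)
Definition no_rotation_factor := forall (t : R) (F G : Omega -> R) (N : set Omega),
  measurable_fun setT F -> measurable_fun setT G -> measurable N -> Q N = 0%E ->
  (forall x, ~ N x -> F (T x) = cos t * F x + sin t * G x) ->
  (forall x, ~ N x -> G (T x) = cos t * G x - sin t * F x) ->
  exists c e M, [/\ measurable M, Q M = 0%E & forall x, ~ M x -> F x = c /\ G x = e].

Let cesaro_bound (w : nat -> R) N x : (forall i, `|w i| <= 1) ->
  `|coef_sum (fun i => w i * f (iter i T x)) (cesaro_poly N)| <= 1.
Proof.
move=> w1; rewrite coef_sum_cesaro normrM ger0_norm ?invr_ge0//.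
case: N => [|N]; first by rewrite invr0 mul0r.
rewrite ler_pdivrMl// mulr1 (le_trans (ler_norm_sum _ _ _))//.
rewrite -[in leRHS](card_ord N.+1) -sumr_const; apply: ler_sum => i _.
by rewrite normrM mulr_ile1.
Qed.

(** Telescoping leaves two boundary terms. The bound holds at every point, as needed for pointwise
    limits. *)
Let cesaro_step (w : nat -> R) N x : (forall i, `|w i| <= 1) ->
  `|coef_sum (fun i => w i * f (iter i T x)) ('X * cesaro_poly N) -
    coef_sum (fun i => w i * f (iter i T x)) (cesaro_poly N)| <= 2 * N%:R^-1.
Proof.
move=> w1; rewrite coef_sumXM !coef_sum_cesaro -mulrBr -sumrB.
rewrite -(big_mkord xpredT (fun i => w i.+1 * f (iter i.+1 T x) - w i * f (iter i T x))).
rewrite telescope_sumr// normrM ger0_norm ?invr_ge0// mulrC ler_wpM2r ?invr_ge0//.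
rewrite (le_trans (ler_normB _ _))// -[2]/(1 + 1) lerD// normrM mulr_ile1//.
Qed.

(** The infimum is approached by averages, not only by arbitrary polynomials; their real and
    imaginary parts are bounded by 1 at every point, as dominated convergence will require. *)
Lemma energy_minimizing_cesaro t (D e : R) (n : nat) : 0 < e ->
  D = inf [set energy t p | p in [set p : {poly R} | p.[1] = 1]] ->
  exists N, (n < N)%N /\ energy t (cesaro_poly N) <= D + e.
Proof.
move=> e0 DE.
have hinf : has_inf [set energy t p | p in [set p : {poly R} | p.[1] = 1]].
  split; first by exists (energy t 1); exists 1 => //=; rewrite hornerC.
  by exists 0 => _ [p _ <-]; exact: energy_ge0.
have e4 : 0 < e / 4 by rewrite divr_gt0.
have [_ [p /= p1 <-]] := inf_adherent e4 hinf; rewrite -DE => pD.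
have [r rP] := energy_cesaro_le p1.
have p0 := energy_ge0 t p; have r0 := energy_ge0 t r.
(* The weight makes [s * energy t p] at most [e / 4]; adding 1 avoids a division by 0. The excess
   over [D] is then three times [e / 4] at most. *)
pose s := e / (4 * (energy t p + 1)).
have s0 : 0 < s by rewrite divr_gt0// mulr_gt0// ltr_wpDl.
have sp : s * energy t p <= e / 4.
  rewrite /s; have -> : e / (4 * (energy t p + 1)) * energy t p =
    e / 4 * (energy t p / (energy t p + 1)) by field; rewrite gt_eqF// ltr_wpDl.
  by rewrite ler_piMr ?(ltW e4)// ler_pdivrMr ?ltr_wpDl// mul1r lerDl.
pose K := (1 + s^-1) * (4 * energy t r) / (e / 4).
have K0 : 0 <= K.
  by rewrite /K divr_ge0 ?(ltW e4)// mulr_ge0 ?mulr_ge0// addr_ge0// invr_ge0 ltW.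
pose N := maxn n.+1 (Num.trunc K).+1.
exists N; split; first by rewrite leq_max leqnn.
have N0 : (0 < N)%N by rewrite leq_max ltn0Sn.
have KN : K <= N%:R ^+ 2.
  rewrite (@le_trans _ _ N%:R)//; last first.
    by rewrite expr2 -natrM ler_nat leq_pmulr.
  rewrite (@le_trans _ _ (Num.trunc K).+1%:R)//; first by rewrite ltW// truncnS_gt.
  by rewrite ler_nat leq_max leqnn orbT.
have N0' : 0 < N%:R ^+ 2 :> R by rewrite exprn_gt0// ltr0n.
apply: le_trans (rP t s N s0 N0) _.
have : (1 + s^-1) * (4 * energy t r / N%:R ^+ 2) <= e / 4.
  rewrite mulrA ler_pdivrMr//; move: KN.
  by rewrite /K ler_pdivrMr// [X in _ <= X -> _]mulrC.
by rewrite mulrDl mul1r; lra.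
Qed.

Hypothesis Ef0 : 'E f = 0.

Lemma expect_coef_sum (w : nat -> R) p :
  'E (fun x => coef_sum (fun i => w i * f (iter i T x)) p) = 0.
Proof.
have bi i : bounded_mfun (fun x => w i * f (iter i T x)).
  by apply: bounded_mfunZ; exact: bounded_mfun_iter.
rewrite /coef_sum expect_sum => [|i]; last exact: bounded_mfunZ.
rewrite big1// => i _; rewrite !expectZ//; last exact: bounded_mfun_iter.
by rewrite expect_iter// Ef0 !mulr0.
Qed.

(* The von Neumann averages attached to [t] form a minimizing sequence for the
   energy, hence are Cauchy in L^2 by the parallelogram law; their limit is an
   eigenfunction of mean 0. *)
Lemma energy_small t (e : R) : no_rotation_factor -> 0 < e ->
  exists2 p : {poly R}, p.[1] = 1 & energy t p < e.
Proof.
move=> nrf e0; apply: contrapT => nex.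
have ge_e p : p.[1] = 1 -> e <= energy t p.
  by move=> p1; rewrite leNgt; apply/negP => h; apply: nex; exists p.
pose S := [set energy t p | p in [set p : {poly R} | p.[1] = 1]].
pose D := inf S.
have lbS : has_lbound S by exists 0 => _ [p _ <-]; exact: energy_ge0.
have DleS p : p.[1] = 1 -> D <= energy t p by move=> p1; apply: ge_inf => //; exists p.
(* With this rate, Chebyshev at level 2^-j leaves exceptional sets of measure at most 4 * 8^-j /
   4^-j = 4 * 2^-j, which is summable. *)
pose eta j : R := 8^-1 ^+ j.
have eta0 j : 0 < eta j by rewrite exprn_gt0// invr_gt0.
have /choice[N NP] j : exists N, (j < N)%N /\ energy t (cesaro_poly N) <= D + eta j.
  exact: energy_minimizing_cesaro.
pose a j := cesaro_poly (N j) : {poly R}.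
have N0 j : (0 < N j)%N by have [+ _] := NP j; exact: leq_ltn_trans.
have a1 j : (a j).[1] = 1 by exact: cesaro_poly1.
have aB j : energy t (a j - a j.+1) <= 4 * eta j.
  have [_ h1] := NP j; have [_ h2] := NP j.+1.
  (* The half sum takes the value 1 at 1, so its energy is at least [D]. *)
  have h3 : 4 * D <= energy t (a j + a j.+1).
    have -> : a j + a j.+1 = 2 *: (2^-1 *: (a j + a j.+1)).
      by rewrite scalerA divff ?scale1r// pnatr_eq0.
    rewrite energyZ -natrX ler_pM2l//; apply: DleS.
    by rewrite !hornerE !a1; field.
  have h4 : eta j.+1 <= eta j by rewrite /eta exprS ler_piMl ?exprn_ge0 ?invr_ge0//
    invf_le1// ler1n.
  have := energy_parallelogram t (a j) (a j.+1).
  by rewrite -/(a j) in h1; rewrite -/(a j.+1) in h2; lra.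
pose C j := cos_part t (a j); pose Z j := sin_part t (a j).
have mC j : measurable_fun setT (C j) by have [] := bounded_cos_part t (a j).
have mZ j : measurable_fun setT (Z j) by have [] := bounded_sin_part t (a j).
have C1 j x : `|C j x| <= 1 by apply: cesaro_bound => i; exact: cos_max.
have Z1 j x : `|Z j x| <= 1 by apply: cesaro_bound => i; exact: sin_max.
have bC j : bounded_mfun (C j) by exact: bounded_cos_part.
have bZ j : bounded_mfun (Z j) by exact: bounded_sin_part.
pose E j := [set x | 2^-1 ^+ j <= `|C j x -
  C j.+1 x|] `|` [set x | 2^-1 ^+ j <= `|Z j x - Z j.+1 x|].
have mle (g : Omega -> R) c : bounded_mfun g -> measurable [set x | c <= `|g x|].
  move=> [mg _]; rewrite -[X in measurable X]setTI.
  by apply: measurable_fun_le => //; exact: measurableT_comp.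
have bCB j : bounded_mfun (fun x => C j x - C j.+1 x) by exact: bounded_mfunB.
have bZB j : bounded_mfun (fun x => Z j x - Z j.+1 x) by exact: bounded_mfunB.
have mE j : measurable (E j) by apply: measurableU; apply: mle.
have QE j : (Q (E j) <= (16 / (2 ^ (j + 1))%:R)%:E)%E.
  have cheb (g : Omega -> R) : bounded_mfun g ->
      'E (fun x => g x ^+ 2) <= energy t (a j - a j.+1) ->
      (Q [set x | (2^-1 ^+ j <= `|g x|)%R] <= (8 / (2 ^ (j + 1))%:R)%:E)%E.
    move=> bg gE; rewrite -fine_probE; last exact: mle.
    have h0 : 0 < 2^-1 ^+ j :> R by rewrite exprn_gt0// invr_gt0.
    rewrite lee_fin (le_trans (chebyshev_sqr Q bg h0))//.
    rewrite ler_pdivrMr; last by rewrite !exprn_gt0// invr_gt0.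
    apply: le_trans gE _; apply: le_trans (aB j) _.
    rewrite /eta addn1 expnS natrM natrX le_eqVlt; apply/orP; left; apply/eqP.
    have -> : 8^-1 ^+ j = (2^-1 ^+ j) ^+ 3 :> R by rewrite -exprM mulnC exprM;
      congr (_ ^+ _); field.
    by rewrite !exprVn; field; rewrite expf_neq0.
  have -> : (16 / (2 ^ (j + 1))%:R)%:E = ((8 / (2 ^ (j + 1))%:R)%:E + (8 / (2 ^ (j +
    1))%:R)%:E)%E :> \bar R.
    by rewrite -EFinD; congr (_%:E); rewrite -mulrDl; congr (_ / _); ring.
  apply: le_trans (measureU2 _ _ _) _; [exact: mle|exact: mle|].
  apply: leeD; apply: cheb => //; apply: expect_le => [||x].
  - exact: bounded_mfunX.
  - exact: bounded_energy.
  - by rewrite /C /Z /cos_part /sin_part !coef_sumB lerDl sqr_ge0.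
  - exact: bounded_mfunX.
  - exact: bounded_energy.
  - by rewrite /C /Z /cos_part /sin_part !coef_sumB lerDr sqr_ge0.
(* Borel-Cantelli: [B] is null, and off [B] the increments of [C] and [Z] are eventually below
   2^-j. *)
pose B := lim_sup_set E.
have mB : measurable B.
  by apply: bigcap_measurable => // k _; exact: bigcup_measurable.
have QB : Q B = 0%E.
  apply: lim_sup_set_cvg0 => //.
  apply: (@le_lt_trans _ _ (\sum_(0 <= n <oo) (16 / (2 ^ (n + 1))%:R)%:E)%E).
    by apply: lee_nneseries => // n _; exact: QE.
  have := @cvg_geometric_eseries_half R 16 0.
  by move=> /cvg_lim -> //; rewrite ltry.
have cvCZ x : ~ B x -> cvgn (C ^~ x) /\ cvgn (Z ^~ x).
  move=> /existsNP[n0 /not_implyP[_ nB]].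
  by split; apply: (@cvg_geometric_increments _ _ n0) => n n0n; rewrite leNgt;
    apply/negP => h; apply: nB; exists n => //; [left|right]; exact: ltW.
(* Upper limits are defined and measurable everywhere, and agree with the limits off [B]. *)
pose F x := limn_sup (C ^~ x); pose G x := limn_sup (Z ^~ x).
have bnd (H : nat -> Omega -> R) x : (forall j x, `|H j x| <= 1) ->
    has_ubound (range (H ^~ x)) /\ has_lbound (range (H ^~ x)).
  move=> H1; split; [exists 1|exists (-1)] => _ [n _ <-];
    by have := H1 n x; rewrite ler_norml => /andP[].
have mF : measurable_fun setT F.
  by apply: measurable_fun_limn_sup => // x _; case: (bnd C x C1).
have mG : measurable_fun setT G.
  by apply: measurable_fun_limn_sup => // x _; case: (bnd Z x Z1).
have CF x : ~ B x -> C ^~ x @ \oo --> F x.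
  by move=> /cvCZ[cC _]; rewrite /F cvg_limn_supE.
have ZG x : ~ B x -> Z ^~ x @ \oo --> G x.
  by move=> /cvCZ[_ cZ]; rewrite /G cvg_limn_supE.
have N_cvg0 : 2 * (N j)%:R^-1 @[j --> \oo] --> (0 : R).
  rewrite -[X in _ --> X](mulr0 2); apply: cvgMl_tmp.
  apply: (@squeeze_cvgr _ _ _ _ (cst 0) (fun n => n.+1%:R^-1)).
  - apply: nearW => n /=; rewrite invr_ge0 ler0n/= lef_pV2 ?posrE ?ltr0n ?ler_nat//.
    by have [] := NP n.
  - exact: cvg_cst.
  - exact: cvg_harmonic.
(* The point [T x] may lie in [B]. Convergence there is read off at [x] instead, where multiplying
   [a j] by ['X] does not change the limit. *)
have step (w : nat -> R) x (l : R) : (forall i, `|w i| <= 1) ->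
    coef_sum (fun i => w i * f (iter i T x)) (a j) @[j --> \oo] --> l ->
    coef_sum (fun i => w i * f (iter i T x)) ('X * a j) @[j --> \oo] --> l.
  move=> w1 al.
  rewrite (_ : (fun j => _) = (fun j => coef_sum (fun i => w i * f (iter i T x)) (a j) +
    (coef_sum (fun i => w i * f (iter i T x)) ('X * a j) -
     coef_sum (fun i => w i * f (iter i T x)) (a j)))); last first.
    by apply/funext => j; rewrite addrC subrK.
  rewrite -[X in _ --> X]addr0; apply: cvgD => //.
  apply/norm_cvg0P; apply: (@squeeze_cvgr _ _ _ _ (cst 0)) N_cvg0; last exact: cvg_cst.
  by apply: nearW => j; rewrite normr_ge0/=; exact: cesaro_step.
have CX x : ~ B x -> cos_part t ('X * a j) x @[j --> \oo] --> F x.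
  by move=> Bx; apply: step; [move=> i; exact: cos_max|exact: CF].
have ZX x : ~ B x -> sin_part t ('X * a j) x @[j --> \oo] --> G x.
  by move=> Bx; apply: step; [move=> i; exact: sin_max|exact: ZG].
have FT x : ~ B x -> F (T x) = cos t * F x + sin t * G x.
  move=> Bx; suff h : C ^~ (T x) @ \oo --> cos t * F x + sin t * G x.
    by rewrite {1}/F; have [_ ->] := cvg_limn_inf_sup h.
  rewrite (_ : C ^~ (T x) = (fun j => cos t * cos_part t ('X * a j) x +
    sin t * sin_part t ('X * a j) x)).
    by apply: cvgD; apply: cvgMl_tmp; [exact: CX|exact: ZX].
  apply/funext => j; rewrite cos_partXM sin_partXM -/(C j) -/(Z j).
  rewrite -[LHS]mul1r -(cos2Dsin2 t); ring.
have GT x : ~ B x -> G (T x) = cos t * G x - sin t * F x.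
  move=> Bx; suff h : Z ^~ (T x) @ \oo --> cos t * G x - sin t * F x.
    by rewrite {1}/G; have [_ ->] := cvg_limn_inf_sup h.
  rewrite (_ : Z ^~ (T x) = (fun j => cos t * sin_part t ('X * a j) x -
    sin t * cos_part t ('X * a j) x)).
    by apply: cvgB; apply: cvgMl_tmp; [exact: ZX|exact: CX].
  apply/funext => j; rewrite cos_partXM sin_partXM -/(C j) -/(Z j).
  rewrite -[LHS]mul1r -(cos2Dsin2 t); ring.
have [c [g [M [mM QM FG]]]] := nrf t F G B mF mG mB QB FT GT.
have QBM : Q (B `|` M) = 0%E by apply: null_set_setU.
have aeBM (p : Omega -> Prop) : (forall x, ~ B x -> ~ M x -> p x) -> {ae Q, forall x,
  p x}.
  move=> hp; exists (B `|` M); split => //; first exact: measurableU.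
  by move=> x /= npx; apply: contrapT => /not_orP[nB nM]; apply: npx; exact: hp.
(* Every [C j] has mean 0, and dominated convergence passes this on to the constant limit. *)
have c0 : c = 0.
  have h : 'E (C j) @[j --> \oo] --> 'E (fun=> c).
    apply: (@expect_cvg _ _ _ _ _ _ 1) => //.
    by apply: aeBM => x nB nM; have [<- _] := FG _ nM; exact: CF.
  rewrite -(expect_cst Q c); apply: (cvg_unique _ h) => //.
  by rewrite (_ : (fun j => _) = cst 0); [exact: cvg_cst|apply/funext => j;
    exact: expect_coef_sum].
have g0 : g = 0.
  have h : 'E (Z j) @[j --> \oo] --> 'E (fun=> g).
    apply: (@expect_cvg _ _ _ _ _ _ 1) => //.
    by apply: aeBM => x nB nM; have [_ <-] := FG _ nM; exact: ZG.
  rewrite -(expect_cst Q g); apply: (cvg_unique _ h) => //.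
  by rewrite (_ : (fun j => _) = cst 0); [exact: cvg_cst|apply/funext => j;
    exact: expect_coef_sum].
have h : energy t (a j) @[j --> \oo] --> 'E (fun=> 0).
  apply: (@expect_cvg _ _ _ _ _ _ 2) => //.
  - by move=> j; case: (bounded_energy t (a j)).
  - move=> j x; rewrite ger0_norm ?addr_ge0 ?sqr_ge0// -[2]/(1 + 1).
    by apply: lerD; rewrite -(real_normK (num_real _)) expr_le1//; [exact: C1|exact: Z1].
  - apply: aeBM => x nB nM; have [Fc Gg] := FG _ nM.
    rewrite (_ : 0 = F x * F x + G x * G x); last by rewrite Fc Gg c0 g0 mulr0 addr0.
    by under eq_cvg do rewrite !expr2; apply: cvgD; apply: cvgM;
      [exact: CF|exact: CF|exact: ZG|exact: ZG].
have : e <= 'E (fun=> 0 : R).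
  apply: (@closed_cvg _ R \oo _ (fun j => energy t (a j)) (fun x => e <= x) _ _ _ h);
    first exact: closed_ge.
  by apply: nearW => j; exact: ge_e.
by rewrite expect_cst leNgt e0.
Qed.


(** A polynomial of small energy at [t0] still has small energy near [t0], and [energy_cesaro_le]
    turns this into a bound for all [t] near [t0] and all large [N]. Compactness of [0, 2 pi], in
    its near-covering form, makes [N] uniform. *)
Lemma energy_cesaro_uniform (e : R) : no_rotation_factor -> 0 < e ->
  \forall N \near \oo, forall t, 0 <= t <= 2 * pi -> energy t (cesaro_poly N) <= e.
Proof.
move=> nrf e0.
have := @segment_compact R 0 (2 * pi); rewrite compact_near_coveringP.
move=> /(_ nat \oo (fun N t => energy t (cesaro_poly N) <= e) _) h.
suff : \forall N \near \oo, `[0, 2 * pi]%classic `<=` (fun t =>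
  energy t (cesaro_poly N) <= e).
  apply: filterS => N hN t t0; apply: hN.
  by rewrite /= in_itv.
apply: h => t0 _.
have e4 : 0 < e / 4 by rewrite divr_gt0.
have [p p1 pe] := energy_small t0 nrf e4.
have [r rP] := energy_cesaro_le p1.
pose K := 8 * (energy t0 r + 1).
have K0 : 0 <= K by rewrite mulr_ge0// addr_ge0// energy_ge0.
have near_p : \forall t \near t0, energy t p < e / 4.
  exact: (cvgr_lt _ (@continuous_energy p t0)).
have near_r : \forall t \near t0, energy t r < energy t0 r + 1.
  by apply: (cvgr_lt _ (@continuous_energy r t0)); rewrite ltrDl.
have near_N : \forall N \near \oo, (0 < N)%N /\ K * N%:R^-1 <= e / 2.
  have KN : K * n%:R^-1 @[n --> \oo] --> (0 : R).
    by rewrite -[X in _ --> X](mulr0 K); apply: cvgMl_tmp; exact: cvg_invn.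
  near=> N; split; first by near: N; exists 1%N.
  apply: ltW; near: N; apply: (cvgr_lt _ KN).
  by rewrite divr_gt0.
near=> t N.
have [N0 KN] : (0 < N)%N /\ K * N%:R^-1 <= e / 2 by near: N.
have tp : energy t p < e / 4 by near: t.
have tr : energy t r < energy t0 r + 1 by near: t.
apply: le_trans (rP t 1 N ltr01 N0) _; rewrite invr1.
have : 4 * energy t r / N%:R ^+ 2 <= K / 2 * N%:R^-1.
  rewrite expr2 invfM mulrA ler_wpM2r ?invr_ge0// ler_pdivrMr ?ltr0n//.
  rewrite (@le_trans _ _ (K / 2))//; first by rewrite /K; lra.
  by rewrite ler_peMr ?ler1n// divr_ge0.
by move: KN; lra.
Unshelve. all: by end_near. Qed.

Lemma autocorrelation_sqr_cvg0 : no_rotation_factor ->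
  (N%:R ^- 2 * \sum_(i < N) \sum_(j < N) b i j ^+ 2) @[N --> \oo] --> (0 : R).
Proof.
move=> nrf; apply/cvgrPdist_le => e e0.
(* Cancels the constant 6 of [toeplitz_sum_sqr_le], since [b 0 0 <= 1]. *)
have e6 : 0 < e / 6 by rewrite divr_gt0.
have := energy_cesaro_uniform nrf e6; move=> unif; near=> N.
have N0 : (0 < N)%N by near: N; exists 1%N.
have hN : forall t, 0 <= t <= 2 * pi -> energy t (cesaro_poly N) <= e / 6 by near: N.
have N2 : 0 < N%:R ^+ 2 :> R by rewrite exprn_gt0// ltr0n.
have sum0 : 0 <= \sum_(i < N) \sum_(j < N) b i j ^+ 2.
  by apply: sumr_ge0 => i _; apply: sumr_ge0 => j _; exact: sqr_ge0.
rewrite sub0r normrN ger0_norm; last by rewrite mulr_ge0// invr_ge0 ltW.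
rewrite ler_pdivrMl//.
have := @toeplitz_sum_sqr_le R b autocorrelation_shift autocorrelation_sym N (N%:R ^+ 2 * (e / 6)) N0.
move=> /(_ _ _)/le_trans; apply.
- move=> t; rewrite energy_cesaro ?muln_gt0// mulr_ge0 ?energy_ge0//.
- move=> l lN; rewrite energy_cesaro// ler_pM2l//; apply: hN.
  have N4 : 0 < (4 * N)%:R :> R by rewrite ltr0n muln_gt0.
  rewrite divr_ge0 ?mulr_ge0 ?pi_ge0 ?(ltW N4)//= ler_pdivrMr//.
  by rewrite ler_pM2l ?mulr_gt0 ?pi_gt0// ler_nat ltnW.
- have := autocorrelation00_le1; move: (b 0 0) => c c1.
  have -> : 6 * c * (N%:R ^+ 2 * (e / 6)) = c * (N%:R ^+ 2 * e) by field.
  by rewrite ler_piMl// mulr_ge0 ?(ltW e0)// ltW.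
Unshelve. all: by end_near. Qed.

End spectral.

(** * From weak mixing of the capacity to an invariant probability without eigenfunctions *)

Section weak_mixing_to_spectral.
Context {d : measure_display} {Omega : measurableType d} {R : realType}.
Variables (T : Omega -> Omega) (V : set Omega -> R) (Q : probability Omega R).
Hypotheses (mT : measurable_fun setT T) (uV : upper_probability V).
Hypotheses (iV : cap_invariant T V) (cQ : core V (fun A => fine (Q A))).
Hypotheses (iQ : invariant_prob T Q) (wV : cap_weakly_mixing T V).

Let V_le0 A B : measurable A -> measurable B -> A `<=` B -> V B = 0 -> V A = 0.
Proof.
case: uV => -[_ [_ [V01 Vmon]]] _ mA mB AB VB; apply/eqP.
by rewrite eq_le -{1}VB Vmon//=; case/andP: (V01 _ mA).
Qed.

Let core_null N : measurable N -> V N = 0 -> Q N = 0%E.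
Proof.
move=> mN VN; apply/fine_prob_eq0 => //; apply/eqP.
rewrite eq_le fine_prob_ge0 andbT -VN.
by case: cQ => _ [_ [_ [_ +]]]; exact.
Qed.

(** The indicator of [A] is an eigenfunction with eigenvalue 1, hence constant off a [V]-null
    set. *)
Lemma weakly_mixing_ergodic A : measurable A -> T @^-1` A = A ->
  V A = 0 \/ V (~` A) = 0.
Proof.
move=> mA TA; pose f x : R[i] := ((\1_A x : R) +i* 0)%C.
have V0 : V set0 = 0 by case: uV => -[].
have [||c [N [mN [VN fc]]]] := wV (f := f) (lam := 1).
- by split => /=; [exact: measurable_indic|exact: measurable_cst].
- exists set0; split => //; split => // x _; rewrite mul1r /f.
  by rewrite -[in RHS]TA.
have [c1|c1] := eqVneq c 1; [right|left].
  apply: (V_le0 _ mN _ VN); first exact: measurableC.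
  move=> x nAx; apply: contrapT => /fc; rewrite c1 /f indicE memNset// => -[] /eqP.
  by rewrite eq_sym oner_eq0.
apply: (V_le0 mA mN _ VN) => x Ax; apply: contrapT => /fc; rewrite /f indicE mem_set//
  => h.
by rewrite -h eqxx in c1.
Qed.

Lemma weakly_mixing_dominated N : measurable N -> Q N = 0%E -> V N = 0.
Proof.
apply: (upper_probability_dominated mT uV iV iQ) => A mA TA QA.
have [//|VCA] := weakly_mixing_ergodic mA TA.
have := core_null (measurableC mA) VCA.
by rewrite probability_setC// QA sube0 => /eqP; rewrite onee_eq0.
Qed.

(** Weak mixing speaks of [V]-null sets. Domination makes the [Q]-null exceptional set [V]-null, and
    [Q <= V] brings the conclusion back to [Q]. *)
Lemma weakly_mixing_no_rotation_factor : no_rotation_factor Q T.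
Proof.
move=> t F G N mF mG mN QN FT GT.
have [||c [M [mM [VM fc]]]] := wV (f := fun x => (F x +i* G x)%C)
    (lam := (cos t +i* - sin t)%C).
- by split.
- exists N; split => //; split; first exact: weakly_mixing_dominated.
  move=> x nN; rewrite FT// GT//; apply/eqP; rewrite eq_complex /=.
  by apply/andP; split; apply/eqP; ring.
exists (complex.Re c), (complex.Im c), M; split => //; first exact: core_null.
by move=> x /fc <-.
Qed.

End weak_mixing_to_spectral.

(** * Mixing for probabilities absolutely continuous with respect to [Q] *)

Section mixing.
Context {d : measure_display} {Omega : measurableType d} {R : realType}.
Variables (T : Omega -> Omega) (Q : probability Omega R).
Hypotheses (mT : measurable_fun setT T) (iQ : invariant_prob T Q).
Hypothesis nrf : no_rotation_factor Q T.

Definition centered_indic (B : set Omega) x : R := \1_B x - fine (Q B).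

Lemma measurable_centered_indic B : measurable B ->
  measurable_fun setT (centered_indic B).
Proof.
by move=> mB; apply: measurable_funB; [exact: measurable_indic|exact: measurable_cst].
Qed.

Lemma centered_indic_le1 B x : measurable B -> `|centered_indic B x| <= 1.
Proof.
move=> mB; rewrite /centered_indic indicE ler_norml.
have := fine_prob_ge0 Q B; have := fine_prob_le1 Q mB.
by case: (x \in B) => /= *; apply/andP; split; lra.
Qed.

Lemma bounded_centered_indic B : measurable B -> bounded_mfun (centered_indic B).
Proof.
by move=> mB; split; [exact: measurable_centered_indic|exists 1 => x;
  exact: centered_indic_le1].
Qed.

Lemma expect_centered_indic B : measurable B -> \int[Q]_x centered_indic B x = 0.
Proof.
move=> mB; rewrite expectB; [|exact: bounded_mfun_indic|exact: bounded_mfun_cst].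
by rewrite expect_indic// expect_cst subrr.
Qed.

Lemma indic_preimage (B : set Omega) (S : Omega -> Omega) x :
  \1_(S @^-1` B) x = \1_B (S x) :> R.
Proof. by []. Qed.

Lemma autocorrelation_centered_indic B i j : measurable B ->
  autocorrelation Q T (centered_indic B) i j =
  fine (Q (iter i T @^-1` B `&` iter j T @^-1` B)) - fine (Q B) ^+ 2.
Proof.
move=> mB; rewrite /autocorrelation /centered_indic; set q := fine (Q B).
have mi k : measurable (iter k T @^-1` B) by exact: measurable_preimage_iter.
transitivity (\int[Q]_x (\1_(iter i T @^-1` B `&` iter j T @^-1` B) x -
    q * (\1_(iter i T @^-1` B) x + \1_(iter j T @^-1` B) x - q))).
  by apply: eq_Rintegral => x _; rewrite indicI !indic_preimage/=; ring.
have bi k : bounded_mfun (\1_(iter k T @^-1` B) : Omega -> R) by exact: bounded_mfun_indic.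
have bq : bounded_mfun (fun x : Omega => q) by exact: bounded_mfun_cst.
have bD : bounded_mfun (fun x => \1_(iter i T @^-1` B) x + \1_(iter j T @^-1` B) x : R).
  exact: bounded_mfunD.
rewrite expectB; [|exact/bounded_mfun_indic/measurableI|exact/bounded_mfunZ/bounded_mfunB].
rewrite expectZ ?expectB ?expectD//; [|exact: bounded_mfunB].
rewrite expect_cst !expect_indic//; last exact: measurableI.
by rewrite !invariant_prob_iter// -/q; ring.
Qed.

Lemma autocorrelation_norm_cvg0 B : measurable B ->
  (N%:R ^- 2 * \sum_(i < N) \sum_(j < N)
     `|autocorrelation Q T (centered_indic B) i j|) @[N --> \oo] --> (0 : R).
Proof.
move=> mB; set b := autocorrelation _ _ _.
have := @autocorrelation_sqr_cvg0 _ _ _ Q T mT iQ _ (measurable_centered_indic mB)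
  (fun x => centered_indic_le1 x mB) (expect_centered_indic mB) nrf.
rewrite -/b => /cvgrPdist_le b0; apply/cvgrPdist_le => e e0.
have e2 : 0 < e / 2 by rewrite divr_gt0.
have /b0 hb : 0 < (e / 2) ^+ 2 by rewrite exprn_gt0.
near=> N.
have : `|0 - N%:R ^- 2 * \sum_(i < N) \sum_(j < N) b i j ^+ 2| <= (e / 2) ^+ 2 by near: N.
have N0 : (0 < N)%N by near: N; exists 1%N.
have N2 : 0 < N%:R ^+ 2 :> R by rewrite exprn_gt0// ltr0n.
rewrite !sub0r !normrN !ger0_norm; last 2 first.
- by rewrite mulr_ge0 ?invr_ge0 ?(ltW N2)//; apply: sumr_ge0 => i _; apply: sumr_ge0 =>
  j _.
- by rewrite mulr_ge0 ?invr_ge0 ?(ltW N2)//; apply: sumr_ge0 => i _; apply: sumr_ge0 =>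
  j _; exact: sqr_ge0.
rewrite !ler_pdivrMl// => h.
(* From squares to absolute values by [|y| <= t + y^2 / t] with [t = e / 2]. *)
have -> : N%:R ^+ 2 * e = \sum_(i < N) \sum_(j < N) (e / 2) +
  (N%:R ^+ 2 * (e / 2) ^+ 2) / (e / 2).
  rewrite !sumr_const !card_ord -mulrnA -[e / 2 *+ _]mulr_natl natrM expr2; field.
  by rewrite gt_eqF.
apply: (@le_trans _ _ (\sum_(i < N) \sum_(j < N) (e / 2) +
  (\sum_(i < N) \sum_(j < N) b i j ^+ 2) / (e / 2))).
  rewrite mulr_suml -big_split/=; apply: ler_sum => i _.
  rewrite mulr_suml -big_split/=; apply: ler_sum => j _.
  rewrite -(real_normK (num_real (b i j))); set y := `|_|; move: (e / 2) e2 => t t0.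
  have -> : t + y ^+ 2 / t = y + t^-1 * ((t - y) ^+ 2 + t * y) by field; rewrite gt_eqF.
  rewrite lerDl; apply: mulr_ge0; first by rewrite invr_ge0 ltW.
  by apply: addr_ge0; [exact: sqr_ge0|apply: mulr_ge0; [exact: ltW|exact: normr_ge0]].
by rewrite lerD2l ler_pM2r// invr_gt0.
Unshelve. all: by end_near. Qed.

(** Otherwise there are sets of summable [Q]-measure whose [P]-measure is at least [e]; their upper
    limit is [Q]-null by Borel-Cantelli but keeps [P]-measure at least [e]. *)
Lemma dominated_epsilon_delta (P : probability Omega R) (e : R) :
  (forall N, measurable N -> Q N = 0%E -> P N = 0%E) -> 0 < e ->
  exists2 r, 0 < r & forall A, measurable A -> fine (Q A) <= r -> fine (P A) < e.
Proof.
move=> PQ e0; apply: contrapT => nex.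
have /choice[A AP] n : exists A, [/\ measurable A,
    fine (Q A) <= 1 / (2 ^ (n + 1))%:R & e <= fine (P A)].
  apply: contrapT => nA; apply: nex; exists (1 / (2 ^ (n + 1))%:R).
    by rewrite divr_gt0// ltr0n expn_gt0.
  move=> A mA QA; rewrite ltNge; apply/negP => PA; apply: nA.
  by exists A.
have mA n : measurable (A n) by case: (AP n).
have QA n : (Q (A n) <= (1 / (2 ^ (n + 1))%:R)%:E)%E.
  by rewrite -fine_probE// lee_fin; case: (AP n).
have Q0 : Q (lim_sup_set A) = 0%E.
  apply: lim_sup_set_cvg0 => //.
  apply: (@le_lt_trans _ _ (\sum_(0 <= n <oo) (1 / (2 ^ (n + 1))%:R)%:E)%E).
    by apply: lee_nneseries => // n _; exact: QA.
  have := @cvg_geometric_eseries_half R 1 0.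
  by move=> /cvg_lim -> //; rewrite ltry.
have mL : measurable (lim_sup_set A).
  by apply: bigcap_measurable => // k _; exact: bigcup_measurable.
have : e <= fine (P (lim_sup_set A)).
  apply: prob_nonincreasing_ge.
  - by move=> n; exact: bigcup_measurable.
  - by move=> m n mn; apply/subsetPset => x [k /= nk Akx]; exists k => //=;
    exact: leq_trans nk.
  - move=> n; have [_ _ eP] := AP n; apply: (le_trans eP); apply: fine_prob_le => //.
      exact: bigcup_measurable.
    by move=> x Ax; exists n => /=.
by rewrite PQ//= leNgt e0.
Qed.

(** One factor of [a i ^+ 2] is kept as a coefficient and the other is written as a [P]-integral
    over [B], so the average of the squares is the [P]-integral over [B] of [h N], the mean of the
    [a i * f (iter i T x)]. As [|a i| <= 1], decay of correlations makes [h N] small in L^2(Q),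
    hence in [Q]-measure, hence in [P]-measure; [h N] is bounded by 1. *)
Lemma no_rotation_factor_mixing (P : probability Omega R) B C :
  (forall N, measurable N -> Q N = 0%E -> P N = 0%E) ->
  measurable B -> measurable C ->
  (fun n : nat => n%:R^-1 * \sum_(i < n)
     `|fine (P (B `&` (iter i T @^-1` C))) - fine (P B) * fine (Q C)| ^+ 2)
    @ \oo --> (0 : R).
Proof.
move=> PQ mB mC; set q := fine (Q C).
pose a i := fine (P (B `&` (iter i T @^-1` C))) - fine (P B) * q.
pose f := centered_indic C.
have mi i : measurable (iter i T @^-1` C) by exact: measurable_preimage_iter.
have bf i : bounded_mfun (fun x => f (iter i T x)).
  exact/bounded_mfun_iter/bounded_centered_indic.
have bfB i : bounded_mfun (fun x => \1_B x * f (iter i T x)).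
  by apply: bounded_mfunM => //; exact: bounded_mfun_indic.
have aE i : a i = \int[P]_x (\1_B x * f (iter i T x)).
  transitivity (\int[P]_x (\1_(B `&` (iter i T @^-1` C)) x - q * \1_B x)).
    rewrite expectB; [|exact/bounded_mfun_indic/measurableI|exact/bounded_mfunZ/bounded_mfun_indic].
    rewrite expectZ; last exact: bounded_mfun_indic.
    by rewrite !expect_indic//; [rewrite mulrC|exact: measurableI].
  by apply: eq_Rintegral => x _;
    rewrite indicI/= indic_preimage /f /centered_indic -/q; ring.
have a1 i : `|a i| <= 1.
  rewrite aE (le_trans (expect_norm _ (bfB i)))// -[leRHS](expect_cst P).
  apply: expect_le => [||x]; [exact: bounded_mfun_norm|exact: bounded_mfun_cst|].
  rewrite normrM mulr_ile1//; last exact: centered_indic_le1.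
  by rewrite indicE normr_nat; case: (_ \in _); rewrite ?ler01.
pose h N x := N%:R^-1 * \sum_(i < N) a i * f (iter i T x).
have bh N : bounded_mfun (h N).
  by apply: bounded_mfunZ; apply: bounded_mfun_sum => i; exact: bounded_mfunZ.
have h1 N x : `|h N x| <= 1.
  rewrite /h normrM ger0_norm ?invr_ge0//.
  case: N => [|N]; first by rewrite invr0 mul0r.
  rewrite ler_pdivrMl// mulr1 (le_trans (ler_norm_sum _ _ _))//.
  rewrite -[in leRHS](card_ord N.+1) -sumr_const; apply: ler_sum => i _.
  by rewrite normrM mulr_ile1//; exact: centered_indic_le1.
have sumE N : N%:R^-1 * \sum_(i < N) `|a i| ^+ 2 = \int[P]_x (\1_B x * h N x).
  transitivity (\int[P]_x (N%:R^-1 * \sum_(i < N) a i * (\1_B x * f (iter i T x)))).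
    rewrite expectZ; last by apply: bounded_mfun_sum => i; exact: bounded_mfunZ.
    rewrite expect_sum; last by move=> i; exact: bounded_mfunZ.
    congr (_ * _); apply: eq_bigr => i _; rewrite expectZ// -aE.
    by rewrite (real_normK (num_real _)) expr2.
  apply: eq_Rintegral => x _; rewrite /h mulrCA; congr (_ * _); rewrite mulr_sumr.
  by apply: eq_bigr => i _; ring.
have hQ N : \int[Q]_x (h N x ^+ 2) <=
    N%:R ^- 2 * \sum_(i < N) \sum_(j < N) `|autocorrelation Q T f i j|.
  have bff i j : bounded_mfun (fun x => f (iter i T x) * f (iter j T x)).
    exact: bounded_mfunM.
  rewrite [leLHS](_ : _ = \int[Q]_x (N%:R ^- 2 * \sum_(i < N) \sum_(j < N)
      (a i * a j) * (f (iter i T x) * f (iter j T x)))); last first.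
    apply: eq_Rintegral => x _; rewrite /h exprMn exprVn; congr (_ * _).
    rewrite expr2 mulr_suml; apply: eq_bigr => i _; rewrite mulr_sumr.
    by apply: eq_bigr => j _; ring.
  have bs i : bounded_mfun (fun x =>
    \sum_(j < N) (a i * a j) * (f (iter i T x) * f (iter j T x))).
    by apply: bounded_mfun_sum => j; exact: bounded_mfunZ.
  rewrite expectZ; last exact: bounded_mfun_sum.
  rewrite ler_wpM2l ?invr_ge0 ?exprn_ge0// expect_sum//; apply: ler_sum => i _.
  rewrite expect_sum; last by move=> j; exact: bounded_mfunZ.
  apply: ler_sum => j _; rewrite expectZ// (le_trans (ler_norm _))// normrM.
  by rewrite ler_piMl// normrM mulr_ile1.
apply/cvgrPdist_le => e e0.
have e2 : 0 < e / 2 by rewrite divr_gt0.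
have [r r0 rP] := dominated_epsilon_delta PQ e2.
have /cvgrPdist_le := autocorrelation_norm_cvg0 mC.
move=> /(_ (r * (e / 2) ^+ 2)) hb.
near=> N; rewrite sub0r normrN sumE.
have mA : measurable [set x | e / 2 <= `|h N x|].
  rewrite -[X in measurable X]setTI.
  by apply: measurable_fun_le => //; apply: measurableT_comp => //; case: (bh N).
have PA : fine (P [set x | e / 2 <= `|h N x|]) < e / 2.
  apply: rP => //; rewrite (le_trans (chebyshev_sqr Q (bh N) e2))//.
  rewrite ler_pdivrMr ?exprn_gt0// (le_trans (hQ N))//.
  rewrite (le_trans (ler_norm _))// -normrN -sub0r; near: N; apply: hb.
  by rewrite mulr_gt0// exprn_gt0.
have bBh : bounded_mfun (fun x => \1_B x * h N x).
  by apply: bounded_mfunM => //; exact: bounded_mfun_indic.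
rewrite (le_trans (expect_norm _ bBh))//.
rewrite (@le_trans _ _ (\int[P]_x (e / 2 + \1_[set x | e / 2 <= `|h N x|] x)))//.
  apply: expect_le => [||x]; first exact: bounded_mfun_norm.
    by apply: bounded_mfunD; [exact: bounded_mfun_cst|exact: bounded_mfun_indic].
  apply: (@le_trans _ _ `|h N x|).
    by rewrite normrM ler_piMl// indicE normr_nat; case: (_ \in _); rewrite ?ler01.
  rewrite indicE; case: (boolP (x \in _)) => [_|];
    first by rewrite (le_trans (h1 _ _))// lerDr ltW.
  by rewrite notin_setE/= => /negP; rewrite -ltNge addr0 => /ltW.
rewrite expectD; [|exact: bounded_mfun_cst|exact: bounded_mfun_indic].
by rewrite expect_cst expect_indic//; lra.
Unshelve. all: by end_near. Qed.

End mixing.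

(** * Ergodicity of the product system *)

Section product_ergodicity.
Context {d : measure_display} {Omega : measurableType d} {R : realType}.
Variables (T : Omega -> Omega) (Q : probability Omega R).
Hypotheses (mT : measurable_fun setT T) (iQ : invariant_prob T Q).
Hypothesis nrf : no_rotation_factor Q T.

(** A name of its own, so that the product measure can be declared a probability. *)
Definition square_prob : set (Omega * Omega) -> \bar R := (Q \x Q)%E.

HB.instance Definition _ := Measure.on square_prob.

Let square_prob_setT : square_prob setT = 1%E.
Proof.
by rewrite -setXTT /square_prob product_measure1E//= probability_setT mule1.
Qed.

HB.instance Definition _ :=
  Measure_isProbability.Build _ _ _ square_prob square_prob_setT.

Let mu : probability (Omega * Omega)%type R := square_prob.

Let muX A B : measurable A -> measurable B -> mu (A `*` B) = (Q A * Q B)%E.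
Proof. exact: product_measure1E. Qed.

Let fine_muX A B : measurable A -> measurable B ->
  fine (mu (A `*` B)) = fine (Q A) * fine (Q B).
Proof. by move=> mA mB; rewrite muX// fineM// fin_num_measure. Qed.

Let S (z : Omega * Omega) := (T z.1, T z.2).

Let mS : measurable_fun setT S.
Proof.
by apply: measurable_fun_pair; apply: (measurableT_comp mT);
  [exact: measurable_fst|exact: measurable_snd].
Qed.

Let mu_invariant D : measurable D -> mu (S @^-1` D) = mu D.
Proof.
move=> mD; apply/esym.
apply: (@product_measure_unique _ _ _ _ R Q Q (pushforward mu S)).
  2: exact: mD.
move=> A B mA mB.
have mTA X : measurable X -> measurable (T @^-1` X).
  by move=> mX; rewrite -[X in measurable X]setTI; exact: mT.
transitivity (mu ((T @^-1` A) `*` (T @^-1` B))); first by [].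
by rewrite muX ?iQ//; exact: mTA.
Qed.

(** An invariant set is independent of every rectangle. All preimages [Rn n] of the rectangle meet
    [A] in the same mass, so the integral over [A] of the averages [X N] of their centered
    indicators is the constant [K]; but [X N] tends to 0 in L^2. *)
Lemma invariant_rectangle A B C : measurable A -> S @^-1` A = A ->
  measurable B -> measurable C ->
  fine (mu (A `&` (B `*` C))) = fine (mu A) * (fine (Q B) * fine (Q C)).
Proof.
move=> mA SA mB mC; set c := fine (Q B) * fine (Q C).
pose Rn n := (iter n T @^-1` B) `*` (iter n T @^-1` C).
have mi n X : measurable X -> measurable (iter n T @^-1` X).
  exact: measurable_preimage_iter.
have mR n : measurable (Rn n) by apply: measurableX; exact: mi.
have muR n : fine (mu (Rn n)) = c.
  by rewrite fine_muX ?invariant_prob_iter//; exact: mi.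
have muAR n : fine (mu (A `&` Rn n)) = fine (mu (A `&` (B `*` C))).
  elim: n => [//|n <-]; congr fine; rewrite -[RHS]mu_invariant; last exact: measurableI.
  rewrite preimage_setI SA; congr (mu (_ `&` _)).
  by rewrite /Rn !preimage_iterS.
pose g n z := \1_(Rn n) z - c.
have bg n : bounded_mfun (g n).
  by apply: bounded_mfunB; [exact: bounded_mfun_indic|exact: bounded_mfun_cst].
pose X N z := N%:R^-1 * \sum_(n < N) g n z.
have bX N : bounded_mfun (X N) by apply: bounded_mfunZ; exact: bounded_mfun_sum.
pose K := fine (mu (A `&` (B `*` C))) - fine (mu A) * c.
have KE N : (0 < N)%N -> \int[mu]_z (\1_A z * X N z) = K.
  move=> N0.
  have bAg n : bounded_mfun (fun z => \1_A z * g n z).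
    by apply: bounded_mfunM => //; exact: bounded_mfun_indic.
  transitivity (\int[mu]_z (N%:R^-1 * \sum_(n < N) (\1_A z * g n z))).
    by apply: eq_Rintegral => z _; rewrite /X mulrCA mulr_sumr.
  rewrite expectZ; last exact: bounded_mfun_sum.
  rewrite expect_sum// (eq_bigr (fun=> K)).
    by rewrite sumr_const card_ord -[K *+ N]mulr_natl mulKf// pnatr_eq0 -lt0n.
  move=> n _; transitivity (\int[mu]_z (\1_(A `&` Rn n) z - c * \1_A z)).
    by apply: eq_Rintegral => z _; rewrite indicI/= /g; ring.
  rewrite expectB; [|exact/bounded_mfun_indic/measurableI|exact/bounded_mfunZ/bounded_mfun_indic].
  rewrite expectZ; last exact: bounded_mfun_indic.
  rewrite !expect_indic//; last exact: measurableI.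
  by rewrite muAR /K mulrC.
pose bB := autocorrelation Q T (centered_indic Q B).
pose bC := autocorrelation Q T (centered_indic Q C).
have gg i j : \int[mu]_z (g i z * g j z) <= `|bB i j| + `|bC i j|.
  have -> : \int[mu]_z (g i z * g j z) = fine (mu (Rn i `&` Rn j)) - c ^+ 2.
    transitivity (\int[mu]_z (\1_(Rn i `&` Rn j) z - c * (\1_(Rn i) z + \1_(Rn j) z -
      c))).
      by apply: eq_Rintegral => z _; rewrite indicI/= /g; ring.
    have bi n : bounded_mfun (\1_(Rn n) : Omega * Omega -> R) by exact: bounded_mfun_indic.
    have bc : bounded_mfun (fun z : Omega * Omega => c) by exact: bounded_mfun_cst.
    have bD : bounded_mfun (fun z => \1_(Rn i) z +
      \1_(Rn j) z : R) by exact: bounded_mfunD.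
    rewrite expectB; [|exact/bounded_mfun_indic/measurableI|exact/bounded_mfunZ/bounded_mfunB].
    rewrite expectZ ?expectB ?expectD//; [|exact: bounded_mfunB].
    rewrite expect_cst !expect_indic//; last exact: measurableI.
    by rewrite !muR; ring.
  have -> : Rn i `&` Rn j = (iter i T @^-1` B `&` iter j T @^-1` B) `*`
      (iter i T @^-1` C `&` iter j T @^-1` C).
    by apply/seteqP; split => z /=; rewrite /Rn /=; tauto.
  rewrite fine_muX; [|exact/measurableI/mi/mB/mi|exact/measurableI/mi/mC/mi].
  rewrite /bB /bC !autocorrelation_centered_indic// /c.
  set x := fine (Q (_ `&` _)); set y := fine (Q (_ `&` _)).
  set x0 := fine (Q B); set y0 := fine (Q C).
  (* Splits the covariance of two rectangles into the correlation of [B] and that of [C], with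
     coefficients at most 1. *)
  have -> : x * y - (x0 * y0) ^+ 2 = (x - x0 ^+ 2) * y + x0 ^+ 2 * (y - y0 ^+ 2) by ring.
  have y01 : `|y| <= 1.
    rewrite ger0_norm ?fine_prob_ge0// fine_prob_le1//.
    exact/measurableI/mi/mC/mi.
  have x01 : `|x0 ^+ 2| <= 1.
    by rewrite normrX expr_le1// ger0_norm ?fine_prob_ge0// fine_prob_le1.
  apply: lerD; rewrite (le_trans (ler_norm _))// normrM.
    by rewrite ler_piMr.
  by rewrite ler_piMl.
have XX N : \int[mu]_z (X N z ^+ 2) <=
    N%:R ^- 2 * \sum_(i < N) \sum_(j < N) `|bB i j| +
    N%:R ^- 2 * \sum_(i < N) \sum_(j < N) `|bC i j|.
  have bgg i j : bounded_mfun (fun z => g i z * g j z) by exact: bounded_mfunM.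
  rewrite [leLHS](_ : _ =
    \int[mu]_z (N%:R ^- 2 * \sum_(i < N) \sum_(j < N) g i z * g j z)); last first.
    apply: eq_Rintegral => z _; rewrite /X exprMn exprVn; congr (_ * _).
    rewrite expr2 mulr_suml; apply: eq_bigr => i _; rewrite mulr_sumr.
    by apply: eq_bigr => j _.
  have bs i : bounded_mfun (fun z =>
    \sum_(j < N) g i z * g j z) by exact: bounded_mfun_sum.
  rewrite expectZ; last exact: bounded_mfun_sum.
  rewrite -mulrDr ler_wpM2l ?invr_ge0 ?exprn_ge0// expect_sum// -big_split/=.
  apply: ler_sum => i _; rewrite expect_sum// -big_split/=.
  by apply: ler_sum => j _; exact: gg.
have cvg0 : N%:R ^- 2 * (\sum_(i < N) \sum_(j < N) `|bB i j|) +
    N%:R ^- 2 * (\sum_(i < N) \sum_(j < N) `|bC i j|) @[N --> \oo] --> (0 : R).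
  by rewrite -[X in _ --> X]addr0; apply: cvgD; exact: autocorrelation_norm_cvg0.
have K0 : `|K| <= 0.
  apply/ler_addgt0Pl => e e0; rewrite addr0.
  have e2 : 0 < e / 2 by rewrite divr_gt0.
  have e22 : 0 < (e / 2) ^+ 2 by rewrite exprn_gt0.
  have [N N0 hN] : exists2 N, (0 < N)%N & \int[mu]_z (X N z ^+ 2) <= (e / 2) ^+ 2.
    have h := cvgr_lt _ cvg0 _ e22.
    have [N _ hN] := h; exists N.+1 => //.
    by rewrite (le_trans (XX N.+1))// ltW//; exact: (hN N.+1 (leqnSn N)).
  rewrite -(KE N N0).
  have bAX : bounded_mfun (fun z => \1_A z * X N z).
    by apply: bounded_mfunM => //; exact: bounded_mfun_indic.
  rewrite (le_trans (expect_norm _ bAX))//.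
  rewrite (@le_trans _ _ (\int[mu]_z `|X N z|))//.
    apply: expect_le => [||z]; [exact: bounded_mfun_norm|exact: bounded_mfun_norm|].
    by rewrite normrM ler_piMl// indicE normr_nat; case: (_ \in _); rewrite ?ler01.
  rewrite (le_trans (expect_norm_le_sqr mu (bX N) e2))//.
  have : \int[mu]_z (X N z ^+ 2) / (e / 2) <= e / 2 by rewrite ler_pdivrMr// -expr2.
  by lra.
by move: K0; rewrite normr_le0 subr_eq0 => /eqP.
Qed.

(** If [A] is not null, the normalized restriction of [mu] to [A] agrees with the product measure on
    rectangles, hence everywhere; at [A] its value is 1. *)
Lemma no_rotation_factor_weakly_mixing : weakly_mixing_prob T Q.
Proof.
split => // A mA SA; rewrite -[(Q \x Q)%E]/(mu : set _ -> _).
have [->|A0] := eqVneq (mu A) 0%E; [by left|right].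
have a0 : 0 < fine (mu A).
  rewrite lt_neqAle fine_prob_ge0 andbT eq_sym; apply: contra_neq A0.
  by move/fine_prob_eq0; exact.
have a0' : 0 <= (fine (mu A))^-1 by rewrite invr_ge0 ltW.
pose r : {nonneg R} := NngNum a0'.
have E : mscale r (mrestr mu mA) A = 1%E.
  transitivity (((fine (mu A))^-1)%:E * mu (A `&` A))%E; first by [].
  by rewrite setIid -(fine_probE mu mA) -EFinM mulVf// gt_eqF.
rewrite -E; apply: (@product_measure_unique _ _ _ _ R Q Q (mscale r (mrestr mu mA)));
  last exact: mA.
move=> B C mB mC; transitivity (((fine (mu A))^-1)%:E * mu (B `*` C `&` A))%E;
  first by [].
rewrite setIC -[X in (_ * X)%E](fine_probE mu); last by apply: measurableI => //;
  exact: measurableX.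
by rewrite invariant_rectangle//= -EFinM mulKf ?gt_eqF// EFinM !fine_probE.
Qed.

End product_ergodicity.

Lemma cesaro_cvg0_lt (R : realType) (u : nat -> R) (m : R) :
  (n%:R^-1 * \sum_(i < n) u i) @[n --> \oo] --> (0 : R) -> 0 < m ->
  exists i, u i < m.
Proof.
move=> u0 m0; apply: contrapT => nex.
have [n _ /(_ n.+1 (leqnSn n))] := cvgr_lt _ u0 _ m0.
rewrite /= ltNge => /negP; apply.
rewrite ler_pdivlMl// mulr_natl -[in leLHS](card_ord n.+1) -sumr_const.
by apply: ler_sum => i _; rewrite leNgt; apply/negP => ui; apply: nex; exists i.
Qed.

(** * Sets of positive probability and almost surely constant functions *)

Section positive_probability.
Context {d : measure_display} {Omega : measurableType d} {R : realType}.
Variable Q : probability Omega R.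

Lemma prob_bigcup_gt0 (F : nat -> set Omega) : (forall n, measurable (F n)) ->
  0 < fine (Q (\bigcup_n F n)) -> exists n, 0 < fine (Q (F n)).
Proof.
move=> mF; rewrite lt_neqAle => /andP[/eqP + _]; apply: contra_notP => nex.
apply/esym/fine_prob_eq0; first exact: bigcup_measurable.
apply/negligibleP; first exact: bigcup_measurable.
apply: negligible_bigcup => n; apply/negligibleP => //.
apply/fine_prob_eq0 => //; apply/eqP; rewrite eq_le fine_prob_ge0 andbT leNgt.
by apply/negP => Fn; apply: nex; exists n.
Qed.

Lemma prob_cover_gt0 (F : nat -> set Omega) : (forall n, measurable (F n)) ->
  (forall x, exists n, F n x) -> exists n, 0 < fine (Q (F n)).
Proof.
move=> mF cF; apply: prob_bigcup_gt0 => //.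
rewrite (_ : \bigcup_n F n = setT) ?probability_setT//=.
by apply/seteqP; split => // x _; have [n Fx] := cF x; exists n.
Qed.

Lemma prob_gt0_point A N : measurable A -> measurable N -> Q N = 0%E ->
  0 < fine (Q A) -> exists x, A x /\ ~ N x.
Proof.
move=> mA mN QN; rewrite lt_neqAle => /andP[/eqP + _]; apply: contra_notP => nex.
apply/esym/fine_prob_eq0 => //; apply: (subset_measure0 mA mN _ QN) => x Ax.
by apply: contrapT => Nx; apply: nex; exists x.
Qed.

Lemma measurable_fun_setle (g : Omega -> R) a : measurable_fun setT g ->
  measurable [set x | g x <= a].
Proof.
move=> mg; rewrite -[X in measurable X]setTI.
by apply: measurable_fun_le => //; exact: measurable_cst.
Qed.

Lemma measurable_fun_setge (g : Omega -> R) a : measurable_fun setT g ->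
  measurable [set x | a <= g x].
Proof.
move=> mg; rewrite -[X in measurable X]setTI.
by apply: measurable_fun_le => //; exact: measurable_cst.
Qed.

Lemma exists_nat_gt (x : R) : exists n : nat, x <= n%:R.
Proof.
have [x0|x0] := leP x 0; first by exists 0%N.
by exists (Num.trunc x).+1; rewrite ltW// truncnS_gt.
Qed.

Lemma exists_nat_inv_lt (x : R) : 0 < x -> exists n : nat, n.+1%:R^-1 <= x.
Proof.
move=> x0; have [n nx] := exists_nat_gt x^-1; exists n.
by rewrite -[x]invrK lef_pV2 ?posrE ?invr_gt0// (le_trans nx)// ler_nat.
Qed.

(** The constant is the essential infimum of [g]: mass at or above some [b > c] would coexist with
    mass at or below some [a < b]. *)
Lemma prob_constant (g : Omega -> R) : measurable_fun setT g ->
  (forall a b, a < b -> 0 < fine (Q [set x | g x <= a]) ->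
     0 < fine (Q [set x | b <= g x]) -> False) ->
  exists c, measurable [set x | g x <> c] /\ Q [set x | g x <> c] = 0%E.
Proof.
move=> mg gab; pose S := [set a | 0 < fine (Q [set x | g x <= a])].
have mle a := measurable_fun_setle a mg; have mge a := measurable_fun_setge a mg.
have [n0 n0P] : exists n : nat, 0 < fine (Q [set x | g x <= n%:R]).
  by apply: prob_cover_gt0 => // x; exact: exists_nat_gt.
have [m0 m0P] : exists n : nat, 0 < fine (Q [set x | - n%:R <= g x]).
  by apply: prob_cover_gt0 => // x; have [n] := exists_nat_gt (- g x); exists n;
    rewrite /= lerNl.
have lbS : lbound S (- m0%:R).
  by move=> a Sa; rewrite leNgt; apply/negP => am; exact: (gab _ _ am Sa m0P).
have iS : has_inf S by split; [exists n0%:R|exists (- m0%:R)].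
pose c := inf S; exists c.
have low a : a < c -> Q [set x | g x <= a] = 0%E.
  move=> ac; apply/fine_prob_eq0 => //; apply/eqP;
    rewrite eq_le fine_prob_ge0 andbT leNgt.
  by apply/negP => Sa; move: ac; rewrite ltNge => /negP; apply; apply: ge_inf => //;
    case: iS.
have up b : c < b -> Q [set x | b <= g x] = 0%E.
  move=> cb; apply/fine_prob_eq0 => //; apply/eqP;
    rewrite eq_le fine_prob_ge0 andbT leNgt.
  apply/negP => Qb; have bc : 0 < b - c by rewrite subr_gt0.
  have [a Sa ab] := inf_adherent bc iS; rewrite -/c addrC subrK in ab.
  exact: (gab _ _ ab Sa Qb).
have -> : [set x | g x <> c] = \bigcup_n ([set x | g x <= c -
  n.+1%:R^-1] `|` [set x | c + n.+1%:R^-1 <= g x]).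
  apply/seteqP; split => x /=.
    move=> /eqP; rewrite neq_lt => /orP[gc|gc].
      have [|n nP] := @exists_nat_inv_lt (c - g x); first by rewrite subr_gt0.
      by exists n => //; left => /=; rewrite lerBrDl -lerBrDr.
    have [|n nP] := @exists_nat_inv_lt (g x - c); first by rewrite subr_gt0.
    by exists n => //; right => /=; rewrite -lerBrDl.
  have h n : 0 < n.+1%:R^-1 :> R by rewrite invr_gt0.
  move=> [n _ [|] /= hx gx]; move: hx (h n); rewrite gx leNgt => /negP hx hn; apply: hx.
    by rewrite ltrBlDr ltrDl.
  by rewrite ltrDl.
have mU n : measurable ([set x | g x <= c - n.+1%:R^-1] `|` [set x | c +
  n.+1%:R^-1 <= g x]).
  exact: measurableU.
split; first exact: bigcup_measurable.
apply/negligibleP; first exact: bigcup_measurable.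
apply: negligible_bigcup => n; apply: negligibleU; apply/negligibleP => //.
  by apply: low; rewrite ltrBlDr ltrDl invr_gt0.
by apply: up; rewrite ltrDl invr_gt0.
Qed.

End positive_probability.

(** * From the mixing condition to weak mixing of the capacity *)

Section mixing_to_weak_mixing.
Context {d : measure_display} {Omega : measurableType d} {R : realType}.
Variables (T : Omega -> Omega) (V : set Omega -> R) (Q : probability Omega R).
Hypotheses (mT : measurable_fun setT T) (uV : upper_probability V).
Hypotheses (iV : cap_invariant T V) (cQ : core V (fun A => fine (Q A))).
Hypotheses (iQ : invariant_prob T Q) (mixQ : mixing_cond T V Q).

Let mi i A : measurable A -> measurable (iter i T @^-1` A).
Proof. exact: measurable_preimage_iter. Qed.

(** For [A] invariant and [Q]-null, take [P] in the core with [P A = V A]. Mixing against the whole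
    space then averages the constant [V A ^+ 2], which must be 0. *)
Lemma mixing_dominated N : measurable N -> Q N = 0%E -> V N = 0.
Proof.
apply: (upper_probability_dominated mT uV iV iQ) => A mA TA QA.
have [P [cP PA]] := upper_probability_core uV mA.
have TiA i : iter i T @^-1` A = A by elim: i => // i ih; rewrite preimage_iterS ih.
apply/eqP; rewrite eq_le; apply/andP; split; last first.
  by case: uV => -[_ [_ [V01 _]]] _; case/andP: (V01 _ mA).
rewrite leNgt; apply/negP => VA.
have [|i] := @cesaro_cvg0_lt R
  (fun i => `|fine (P (setT `&` iter i T @^-1` A)) - fine (P setT) * fine (Q A)| ^+ 2)
  (V A ^+ 2) (mixQ cP measurableT mA).
  by rewrite exprn_gt0.
rewrite setTI TiA PA QA /= mulr0 subr0 (real_normK (num_real _)).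
by rewrite ltxx.
Qed.

(** Two nonnegative sequences with averages tending to 0 are small at a common index, as their sum
    is. This is what makes the two visits simultaneous. *)
Lemma mixing_joint_recurrence B C1 C2 :
  measurable B -> measurable C1 -> measurable C2 ->
  0 < fine (Q B) -> 0 < fine (Q C1) -> 0 < fine (Q C2) ->
  exists i, 0 < fine (Q (B `&` iter i T @^-1` C1)) /\
            0 < fine (Q (B `&` iter i T @^-1` C2)).
Proof.
move=> mB m1 m2 QB Q1 Q2.
pose u C i := `|fine (Q (B `&` iter i T @^-1` C)) - fine (Q B) * fine (Q C)| ^+ 2.
have cvgu : n%:R^-1 * \sum_(i < n) (u C1 i + u C2 i) @[n --> \oo] --> (0 : R).
  rewrite -[X in _ --> X]addr0.
  rewrite (_ : (fun n => _) = (fun n => n%:R^-1 * (\sum_(i < n) u C1 i) +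
    n%:R^-1 * (\sum_(i < n) u C2 i))).
    by apply: cvgD; [exact: (mixQ cQ mB m1)|exact: (mixQ cQ mB m2)].
  by apply/funext => n; rewrite big_split/= mulrDr.
pose m := Num.min ((fine (Q B) * fine (Q C1)) ^+ 2) ((fine (Q B) * fine (Q C2)) ^+ 2).
have m0 : 0 < m by rewrite lt_min !exprn_gt0// mulr_gt0.
have [i ui] := @cesaro_cvg0_lt R (fun i => u C1 i + u C2 i) m cvgu m0.
have u0 C j : 0 <= u C j by exact: sqr_ge0.
have pos C : measurable C -> m <= (fine (Q B) * fine (Q C)) ^+ 2 -> u C i < m ->
    0 < fine (Q (B `&` iter i T @^-1` C)).
  move=> mC mle um; rewrite lt_neqAle fine_prob_ge0 andbT; apply: contraTN um => /eqP h.
  by rewrite -leNgt /u -h sub0r normrN (real_normK (num_real _)).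
exists i; split; apply: pos => //.
- by rewrite ge_min lexx.
- by apply: le_lt_trans ui; rewrite lerDl.
- by rewrite ge_min lexx orbT.
- by apply: le_lt_trans ui; rewrite lerDr.
Qed.

(** The squared modulus as an element of [R]; the norm of [R[i]] takes its values in [R[i]]. *)
Let sqmod (z : R[i]) := complex.Re z ^+ 2 + complex.Im z ^+ 2.

Let sqmodM z w : sqmod (z * w) = sqmod z * sqmod w.
Proof. by case: z => a b; case: w => c e; rewrite /sqmod /=; ring. Qed.

Let sqmodX z n : sqmod (z ^+ n) = sqmod z ^+ n.
Proof.
elim: n => [|n ih]; first by rewrite !expr0 /sqmod/= expr1n expr0n addr0.
by rewrite !exprS sqmodM ih.
Qed.

Let sqmod_ge0 z : 0 <= sqmod z.
Proof. by rewrite addr_ge0 ?sqr_ge0. Qed.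

Section eigenfunction.
Variables (f : Omega -> R[i]) (lam : R[i]) (N : set Omega).
Hypotheses (mf : measurable_C f) (mN : measurable N) (QN : Q N = 0%E).
Hypothesis fT : forall x i, ~ N x -> f (iter i T x) = lam ^+ i * f x.

Let g x := complex.Re (f x).
Let h x := complex.Im (f x).
Let mg : measurable_fun setT g. Proof. by case: mf. Qed.
Let mh : measurable_fun setT h. Proof. by case: mf. Qed.

Let mw : measurable_fun setT (fun x => sqmod (f x)).
Proof. by apply: measurable_funD; exact: measurable_funX. Qed.

(** Along orbits starting where [f] is bounded away from 0 the modulus grows without bound, whereas
    mixing brings some of these points back, at a late time, to a set where the modulus is at most
    [m]. *)
Lemma expanding_eigenfunction_eq0 : 1 < sqmod lam ->
  Q [set x | f x <> 0] = 0%E.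
Proof.
move=> lam1.
pose A k := [set x | k.+1%:R^-1 <= sqmod (f x)].
have mA k : measurable (A k) by exact: measurable_fun_setge.
have -> : [set x | f x <> 0] = \bigcup_k A k.
  apply/seteqP; split => x /=.
    move=> fx; have [|k kP] := @exists_nat_inv_lt R (sqmod (f x)); last by exists k.
    rewrite lt_neqAle sqmod_ge0 andbT eq_sym; apply/eqP => /eqP.
    rewrite paddr_eq0 ?sqr_ge0// !sqrf_eq0 => /andP[/eqP r0 /eqP i0]; apply: fx.
    by apply/eqP; rewrite eq_complex r0 i0 !eqxx.
  move=> [k _ Ak] fx; move: Ak; rewrite /A /= fx /sqmod /= expr0n addr0 leNgt.
  by rewrite invr_gt0 ltr0n.
have mU : measurable (\bigcup_k A k) by exact: bigcup_measurable.
apply/fine_prob_eq0 => //; apply/eqP; rewrite eq_le fine_prob_ge0 andbT leNgt.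
apply/negP => /prob_bigcup_gt0 -/(_ mA)[k QA].
have [m Qm] : exists m : nat, 0 < fine (Q [set x | sqmod (f x) <= m%:R]).
  apply: prob_cover_gt0 => [n|x]; first exact: measurable_fun_setle.
  exact: exists_nat_gt.
have [i0 i0P] : exists i0 : nat, forall i,
  (i0 <= i)%N -> m%:R < sqmod lam ^+ i * k.+1%:R^-1.
  have l0 : 0 < sqmod lam - 1 by rewrite subr_gt0.
  have [i0 hi0] := exists_nat_gt (m%:R * k.+1%:R / (sqmod lam - 1)).
  exists i0 => i ii; rewrite ltr_pdivlMr ?ltr0n//.
  have bern j : 1 + j%:R * (sqmod lam - 1) <= sqmod lam ^+ j.
    elim: j => [|j ih]; first by rewrite mul0r addr0 expr0.
    rewrite exprS -natr1.
    have : 0 <= (sqmod lam - 1) * (sqmod lam ^+ j - 1).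
      by rewrite mulr_ge0 ?(ltW l0)// subr_ge0 exprn_ege1// ltW.
    by move: ih; move: (sqmod lam ^+ j) => y ih; lra.
  rewrite ler_pdivrMr// in hi0.
  apply: lt_le_trans (bern i).
  have : i0%:R * (sqmod lam - 1) <= i%:R * (sqmod lam - 1) by rewrite ler_pM2r// ler_nat.
  by move: hi0; lra.
(* Joint recurrence does not control the time [i]; targeting the preimage under [iter i0 T] makes
   the total time [i0 + i] at least [i0]. *)
have mD : measurable (iter i0 T @^-1` [set x | sqmod (f x) <= m%:R]).
  exact/mi/measurable_fun_setle.
have QD : 0 < fine (Q (iter i0 T @^-1` [set x | sqmod (f x) <= m%:R])).
  by rewrite invariant_prob_iter//; exact: measurable_fun_setle.
have [i [Qi _]] := mixing_joint_recurrence (mA k) mD mD QA QD QD.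
have [|x [[Ax Dx] Nx]] := prob_gt0_point _ mN QN Qi; first exact/measurableI/mi.
move: Dx; rewrite /preimage /= -iterD fT// sqmodM sqmodX => Dx.
have := i0P (i0 + i)%N (leq_addr _ _); rewrite ltNge => /negP; apply.
apply: le_trans Dx; rewrite ler_wpM2l// exprn_ge0//.
Qed.

Lemma contracting_eigenfunction_constant : sqmod lam <= 1 ->
  forall k : Omega -> R, measurable_fun setT k -> (forall x y,
     (k x - k y) ^+ 2 <= sqmod (f x - f y)) ->
  exists c, measurable [set x | k x <> c] /\ Q [set x | k x <> c] = 0%E.
Proof.
move=> lam1 k mk kf; apply: prob_constant => // a b ab Qa Qb.
(* Two points of a cell of side [e] have values at squared distance below [2 e^2], and this is not
   increased by the iterates of [lam]; values at most [a] and at least [b] are at squared distance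
   at least [4 e^2]. *)
pose e := (b - a) / 2.
have e0 : 0 < e by rewrite divr_gt0// subr_gt0.
pose cell (u : Omega -> R) (z : int) := [set x | z%:~R * e <= u x] `&` ~` [set x | (z +
  1)%:~R * e <= u x].
have mcell u z : measurable_fun setT u -> measurable (cell u z).
  by move=> mu; apply: measurableI; [|apply: measurableC]; exact: measurable_fun_setge.
(* The grid of cells in the plane is enumerated by the codes of pairs of integers; numbers that code
   nothing give the empty set. *)
pose box n := if (unpickle n : option (int * int)) is Some z
  then cell g z.1 `&` cell h z.2 else set0.
have mbox n : measurable (box n).
  rewrite /box; case: unpickle => // z.
  by apply: measurableI; exact: mcell.
have incell u x : cell u (Num.floor (u x / e)) x.
  split => /=; first by rewrite -ler_pdivlMr// floor_le_tmp.
  by apply/negP; rewrite -ltNge -ltr_pdivrMr// floorD1_gt.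
have cellB u z x y : cell u z x -> cell u z y -> (u x - u y) ^+ 2 < e ^+ 2.
  move=> [/= x1 /negP x2] [/= y1 /negP y2]; rewrite -ltNge intrD mulrDl mul1r in x2.
  rewrite -ltNge intrD mulrDl mul1r in y2.
  rewrite -(real_normK (num_real (u x - u y))) ltr_sqr ?nnegrE ?normr_ge0 ?(ltW e0)//.
  by rewrite ltr_norml; apply/andP; split; lra.
have [n Qn] : exists n, 0 < fine (Q (box n)).
  apply: prob_cover_gt0 => // x.
  exists (pickle (Num.floor (g x / e), Num.floor (h x / e))).
  by rewrite /box pickleK; split; exact: incell.
have ma := measurable_fun_setle a mk; have mb := measurable_fun_setge b mk.
have [i [Q1 Q2]] := mixing_joint_recurrence (mbox n) ma mb Qn Qa Qb.
have [|x [[Bx ax] Nx]] := prob_gt0_point _ mN QN Q1; first exact/measurableI/mi.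
have [|y [[By bY] Ny]] := prob_gt0_point _ mN QN Q2; first exact/measurableI/mi.
rewrite /preimage /= in ax bY.
have := kf (iter i T y) (iter i T x); rewrite !fT// -mulrBr sqmodM sqmodX.
have lami : sqmod lam ^+ i <= 1 by rewrite exprn_ile1.
have small : sqmod (f y - f x) < 2 * e ^+ 2.
  move: Bx By; rewrite /box; case: unpickle => // z [gx hx] [gy hy].
  have := cellB _ _ _ _ gy gx; have := cellB _ _ _ _ hy hx.
  by rewrite /sqmod /g /h; case: (f x) => ? ?; case: (f y) => ? ? /=; lra.
have big : 4 * e ^+ 2 <= (k (iter i T y) - k (iter i T x)) ^+ 2.
  by rewrite (_ : 4 * e ^+ 2 = (2 * e) ^+ 2); [|ring]; rewrite ler_sqr ?nnegrE;
    rewrite /e; lra.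
have := sqmod_ge0 (f y - f x); move: small big.
have : 0 < e ^+ 2 by rewrite exprn_gt0.
move: (sqmod (f y - f x)) (sqmod lam ^+ i) lami ((k _ - k _) ^+ 2) (e ^+ 2).
by move=> s l l1 K E E0 sE EK s0 Kls; have := ler_piMl s0 l1; lra.
Qed.

Lemma eigenfunction_constant :
  exists c, measurable [set x | f x <> c] /\ Q [set x | f x <> c] = 0%E.
Proof.
have neqE (c : R[i]) : [set x | f x <> c] =
    [set x | g x <> complex.Re c] `|` [set x | h x <> complex.Im c].
  apply/seteqP; split => x /=.
    move=> fc; apply: contrapT => /not_orP[/contrapT gc /contrapT hc]; apply: fc.
    by apply/eqP; rewrite eq_complex -gc -hc !eqxx.
  by move=> [gc|hc] fc; [apply: gc|apply: hc]; rewrite /g /h fc.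
have mneq k c : measurable_fun setT k -> measurable [set x : Omega | k x <> c :> R].
  move=> mk; rewrite (_ : mkset _ = ~` ([set x | k x <= c] `&` [set x | c <= k x])).
    by apply: measurableC; apply: measurableI;
      [exact: measurable_fun_setle|exact: measurable_fun_setge].
  apply/seteqP; split => x /=; first by move=> kc [k1 k2]; apply: kc; apply/eqP;
    rewrite eq_le k1.
  by move=> kc e; apply: kc; rewrite e.
have [lam1|lam1] := leP (sqmod lam) 1; last first.
  exists 0; split; last exact: expanding_eigenfunction_eq0.
  by rewrite neqE; apply: measurableU; exact: mneq.
have [|c [mc Qc]] := contracting_eigenfunction_constant lam1 mg.
  by move=> x y; rewrite /sqmod /g; case: (f x) => ? ?; case: (f y) => ? ? /=;
    rewrite lerDl sqr_ge0.
have [|e [me Qe]] := contracting_eigenfunction_constant lam1 mh.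
  by move=> x y; rewrite /sqmod /h; case: (f x) => ? ?; case: (f y) => ? ? /=;
    rewrite lerDr sqr_ge0.
exists (c +i* e)%C; rewrite neqE/=; split; first exact: measurableU.
by apply: null_set_setU.
Qed.

End eigenfunction.

Lemma mixing_weakly_mixing : cap_weakly_mixing T V.
Proof.
move=> f lam mf [N [mN [VN fT]]].
have QN : Q N = 0%E.
  apply/fine_prob_eq0 => //; apply/eqP; rewrite eq_le fine_prob_ge0 andbT -VN.
  by case: cQ => _ [_ [_ [_ +]]]; exact.
(* Off [M] no point of the orbit meets [N], so the eigenvalue equation can be iterated; [M] stays
   [Q]-null by invariance. *)
pose M := \bigcup_k (iter k T @^-1` N).
have mM : measurable M by apply: bigcup_measurable => k _; exact: mi.
have QM : Q M = 0%E.
  apply/negligibleP => //; apply: negligible_bigcup => k; apply/negligibleP;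
    first exact: mi.
  by rewrite [LHS](invariant_prob_iter mT k iQ mN).
have fM x i : ~ M x -> f (iter i T x) = lam ^+ i * f x.
  move=> nM; elim: i => [|i ih]; first by rewrite expr0 mul1r.
  rewrite iterS fT; first by rewrite ih exprS mulrA.
  by move=> Ni; apply: nM; exists i.
have [c [mc Qc]] := eigenfunction_constant mf mM QM fM.
exists c, [set x | f x <> c]; split => //; split; first exact: mixing_dominated.
by move=> x /= /contrapT.
Qed.

End mixing_to_weak_mixing.

Theorem theorem5p8 (d : measure_display) (Omega : measurableType d) (R : realType)
  (T : Omega -> Omega) (V : set Omega -> R) :
  measurable_fun setT T ->
  upper_probability V ->
  cap_invariant T V ->
  [/\ (cap_weakly_mixing T V ->
        exists Q : probability Omega R,
          [/\ core V (fun A => fine (Q A)), weakly_mixing_prob T Q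
            & mixing_cond T V Q]),
      ((exists Q : probability Omega R,
          [/\ core V (fun A => fine (Q A)), weakly_mixing_prob T Q
            & mixing_cond T V Q]) ->
        exists Q : probability Omega R,
          [/\ core V (fun A => fine (Q A)), invariant_prob T Q
            & mixing_cond T V Q])
    & ((exists Q : probability Omega R,
          [/\ core V (fun A => fine (Q A)), invariant_prob T Q
            & mixing_cond T V Q]) ->
        cap_weakly_mixing T V)].
Proof.
move=> mT uV iV; split.
- move=> wV; have [Q [cQ iQ]] := core_invariant_probability mT uV iV.
  have nrf := weakly_mixing_no_rotation_factor mT uV iV cQ iQ wV.
  exists Q; split => //; first exact: no_rotation_factor_weakly_mixing.
  (* [P] is only finitely additive by definition; integration is available for the probability [P']
     that agrees with it on measurable sets. *)
  move=> P cP B C mB mC; have [P' PE] := core_probability uV cP.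
  have PQ N : measurable N -> Q N = 0%E -> P' N = 0%E.
    move=> mN QN; apply/fine_prob_eq0 => //; apply/eqP.
    rewrite eq_le fine_prob_ge0 andbT PE//.
    rewrite -(weakly_mixing_dominated mT uV iV cQ iQ wV mN QN).
    by case: cP => _ [_ [_ [_ +]]]; exact.
  have := no_rotation_factor_mixing mT iQ nrf PQ mB mC.
  rewrite (_ : (fun n => _) = (fun n : nat => n%:R^-1 *
    \sum_(i < n) `|P (B `&` iter i T @^-1` C) - P B * fine (Q C)| ^+ 2))//.
  apply/funext => n; congr (_ * _); apply: eq_bigr => i _.
  by rewrite !PE//; apply: measurableI => //; exact: measurable_preimage_iter.
- by move=> [Q [cQ [iQ _] mixQ]]; exists Q.
- by move=> [Q [cQ iQ mixQ]]; exact: mixing_weakly_mixing mixQ.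
Qed.
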